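(* Let $n\ge2$, $p$ a prime, and $V_n(\mathbb{Z}_p)_{p \nmid a_n} = \{x^n + a_1 x^{n - 1} + \ldots + a_n \in \mathbb{Z}_p[x] : p \nmid a_n\}$. Then \begin{align*} P^{\max}(V_n(\mathbb{Z}_p)_{p \nmid a_n}) &= 1 - \frac{1}{p^2 + p + 1} + \begin{cases} \dfrac{1}{(p^2 + p + 1) p^{3(n - 1)/2}} & \text{if } 2 \nmid n, \\ -\dfrac{p + 1}{(p^2 + p + 1) p^{3n/2 - 1}} & \text{if } 2 \mid n, \end{cases} \\ P_0^{\mathrm{sqf}}(V_n(\mathbb{Z}_p)_{p \nmid a_n}) &= \frac{p}{p + 1} \left(1 - \frac{(-1)^n}{p^n}\right). \end{align*} Moreover $P_1^{\mathrm{sqf}}(V_n(\mathbb{Z}_2)_{2 \nmid a_n}) = 0$, and if $p$ is odd, then \[ P_1^{\mathrm{sqf}}(V_n(\mathbb{Z}_p)_{p \nmid a_n}) = \frac{(p - 1)^2}{p(p + 1)^2} - \frac{(-1)^n}{p^n} \left((n - 1) \frac{(p - 1)^2}{p + 1} - \frac{p(p - 1)(p + 3)}{(p + 1)^2}\right). \]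
   Context: $V_n(\mathbb{Z}_p)$ is the set of monic degree-$n$ polynomials over $\mathbb{Z}_p$, identified with $\mathbb{Z}_p^n$ via coefficients, with Haar measure. Densities are ratios of measures: $P_0^{\mathrm{sqf}}$ is the density of $f$ with $p\nmid\mathrm{Disc}(f)$, $P_1^{\mathrm{sqf}}$ the density of $f$ with $v_p(\mathrm{Disc}(f))=1$, and $P^{\max}$ the density of $f$ with $\mathbb{Z}_p[x]/(f(x))$ the maximal order of $\mathbb{Q}_p[x]/(f(x))$. *)

(* Defs.v *)
From HB Require Import structures.
From mathcomp Require Import all_boot all_order all_algebra.
From mathcomp Require Import all_classical all_reals all_analysis.

Set Implicit Arguments.
Unset Strict Implicit.
Unset Printing Implicit Defensive.

Import Order.TTheory GRing.Theory Num.Theory.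

Local Open Scope classical_set_scope.
Local Open Scope ring_scope.

(* The ring Z_p, as the inverse limit of the rings Z/p^(k+1), k >= 0.  (The   *)
(* index is shifted because 'Z_1 denotes Z/2 rather than the zero ring.)      *)
(* The primality proof is a parameter of the type so that the integral domain *)
(* structure can be inferred.                                                 *)
Record padic_int (p : nat) (pr_p : prime p) := PadicInt {
  residue : forall k, 'Z_(p ^ k.+1);
  residueP : forall k, (residue k.+1 : nat)%:R = residue k }.

Section PadicRing.
Variables (p : nat) (pr_p : prime p).
Local Notation Zp := (padic_int pr_p).
Implicit Types x y z : Zp.

HB.instance Definition _ := gen_eqMixin Zp.
HB.instance Definition _ := gen_choiceMixin Zp.

Lemma padicP x y : (forall k, residue x k = residue y k) -> x = y.
Proof.
case: x => x xP; case: y => y yP /= exy.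
have e : x = y by apply: functional_extensionality_dep.
by move: xP yP; rewrite e => xP yP; congr PadicInt; exact: Prop_irrelevance.
Qed.

Fact gt1_pX k : (1 < p ^ k.+1)%N.
Proof. by rewrite -(exp1n k.+1) ltn_exp2r // prime_gt1. Qed.

Fact residueD k (a b : 'Z_(p ^ k.+1)) :
  ((a + b)%R : nat) = ((a + b) %% p ^ k.+1)%N.
Proof. by congr (_ %% _)%N; exact: Zp_cast (gt1_pX k). Qed.

Fact residueM k (a b : 'Z_(p ^ k.+1)) :
  ((a * b)%R : nat) = ((a * b) %% p ^ k.+1)%N.
Proof. by congr (_ %% _)%N; exact: Zp_cast (gt1_pX k). Qed.

Definition reduct k (a : 'Z_(p ^ k.+2)) : 'Z_(p ^ k.+1) := (a : nat)%:R.

Fact natr_modpX k a : ((a %% p ^ k.+2)%N%:R : 'Z_(p ^ k.+1)) = a%:R.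
Proof.
apply: val_inj; rewrite /= !val_Zp_nat ?gt1_pX //.
by rewrite modn_dvdm // dvdn_exp2l.
Qed.

Fact reductD k : {morph @reduct k : a b / a + b}.
Proof. by move=> a b; rewrite /reduct residueD natr_modpX natrD. Qed.

Fact reductM k : {morph @reduct k : a b / a * b}.
Proof. by move=> a b; rewrite /reduct residueM natr_modpX natrM. Qed.

Fact reduct0 k : @reduct k 0 = 0. Proof. by []. Qed.

Fact reduct1 k : @reduct k 1 = 1. Proof. by []. Qed.

Fact reductN k : {morph @reduct k : a / - a}.
Proof.
by move=> a; apply/eqP; rewrite -subr_eq0 opprK -reductD addNr reduct0.
Qed.

Definition padic_zero : Zp := @PadicInt p pr_p (fun=> 0) reduct0.

Definition padic_one : Zp := @PadicInt p pr_p (fun=> 1) reduct1.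

Fact padic_opp_subproof x k : reduct (- residue x k.+1) = - residue x k.
Proof. by rewrite reductN [reduct _]residueP. Qed.

Definition padic_opp x : Zp :=
  @PadicInt p pr_p (fun k => - residue x k) (padic_opp_subproof x).

Fact padic_add_subproof x y k :
  reduct (residue x k.+1 + residue y k.+1) = residue x k + residue y k.
Proof. by rewrite reductD ![reduct _]residueP. Qed.

Definition padic_add x y : Zp :=
  @PadicInt p pr_p (fun k => residue x k + residue y k)
    (padic_add_subproof x y).

Fact padic_mul_subproof x y k :
  reduct (residue x k.+1 * residue y k.+1) = residue x k * residue y k.
Proof. by rewrite reductM ![reduct _]residueP. Qed.

Definition padic_mul x y : Zp :=
  @PadicInt p pr_p (fun k => residue x k * residue y k)
    (padic_mul_subproof x y).

Fact padic_addA : associative padic_add.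
Proof. by move=> x y z; apply: padicP => k /=; rewrite addrA. Qed.

Fact padic_addC : commutative padic_add.
Proof. by move=> x y; apply: padicP => k /=; rewrite addrC. Qed.

Fact padic_add0 : left_id padic_zero padic_add.
Proof. by move=> x; apply: padicP => k /=; rewrite add0r. Qed.

Fact padic_addN : left_inverse padic_zero padic_opp padic_add.
Proof. by move=> x; apply: padicP => k /=; rewrite addNr. Qed.

HB.instance Definition _ :=
  GRing.isZmodule.Build Zp padic_addA padic_addC padic_add0 padic_addN.

Fact padic_mulA : associative padic_mul.
Proof. by move=> x y z; apply: padicP => k /=; rewrite mulrA. Qed.

Fact padic_mulC : commutative padic_mul.
Proof. by move=> x y; apply: padicP => k /=; rewrite mulrC. Qed.

Fact padic_mul1 : left_id padic_one padic_mul.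
Proof. by move=> x; apply: padicP => k /=; rewrite mul1r. Qed.

Fact padic_mulDl : left_distributive padic_mul padic_add.
Proof. by move=> x y z; apply: padicP => k /=; rewrite mulrDl. Qed.

Fact padic_one_neq0 : padic_one != 0.
Proof.
apply/eqP => e; have /eqP := congr1 (fun x : Zp => residue x 0%N) e.
by rewrite /= oner_eq0.
Qed.

HB.instance Definition _ :=
  GRing.Zmodule_isComNzRing.Build Zp
    padic_mulA padic_mulC padic_mul1 padic_mulDl padic_one_neq0.

Definition padic_unit : {pred Zp} := fun x => `[< exists y, y * x = 1 >].

Definition padic_inv x : Zp :=
  if x \in padic_unit then xget 0 [set y | y * x = 1] else x.

Fact padic_mulVr : {in padic_unit, left_inverse 1 padic_inv *%R}.
Proof.
move=> x ux; rewrite /padic_inv ux.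
by have /asboolP[y yx] := ux; exact: (@xgetI _ 0 [set y | y * x = 1] y).
Qed.

Fact padic_unitP x y : y * x = 1 -> x \in padic_unit.
Proof. by move=> yx; apply/asboolP; exists y. Qed.

Fact padic_inv_out : {in [predC padic_unit], padic_inv =1 id}.
Proof. by move=> x /negPf nux; rewrite /padic_inv nux. Qed.

HB.instance Definition _ :=
  GRing.ComNzRing_hasMulInverse.Build Zp padic_mulVr padic_unitP padic_inv_out.

Fact residue_modn x j k :
  (residue x (k + j) = residue x k %[mod p ^ k.+1])%N.
Proof.
elim: j => [|j IHj]; first by rewrite addn0.
rewrite -{}IHj addnS -[in RHS]residueP val_Zp_nat ?gt1_pX // modn_dvdm //.
by rewrite dvdn_exp2l // ltnS leq_addr.
Qed.

Fact residue_neq0 x : x != 0 -> exists k, ~~ (p ^ k.+1 %| residue x k)%N.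
Proof.
move=> x0; apply: contrapT => nx; case/eqP: x0; apply: padicP => k /=.
apply: val_inj => /=; apply/eqP; rewrite -[_ == _]negbK; apply/negP => xk.
apply: nx; exists k; apply: contra xk => /eqP.
rewrite modn_small => [->//|].
by rewrite -[X in (_ < X)%N](Zp_cast (gt1_pX k)) ltn_ord.
Qed.

Fact padic_idomain : GRing.integral_domain_axiom Zp.
Proof.
move=> x y xy0; apply/norP => -[/residue_neq0[i xi] /residue_neq0[j yj]].
have := congr1 (fun z : Zp => residue z (i + j.+1) : nat) xy0.
rewrite residueM => /eqP pxy.
pose a : nat := residue x (i + j.+1); pose b : nat := residue y (i + j.+1).
have {}xi : ~~ (p ^ i.+1 %| a)%N by rewrite /dvdn /a residue_modn.
have {}yj : ~~ (p ^ j.+1 %| b)%N by rewrite /dvdn /b -addSnnS addnC residue_modn.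
have a0 : (0 < a)%N by rewrite lt0n; apply: contra xi => /eqP->; rewrite dvdn0.
have b0 : (0 < b)%N by rewrite lt0n; apply: contra yj => /eqP->; rewrite dvdn0.
move: pxy; rewrite -/a -/b -/(dvdn _ _) pfactor_dvdn ?muln_gt0 ?a0 // lognM //.
move: xi yj; rewrite !pfactor_dvdn // -!ltnNge !ltnS => ai bj.
rewrite addnS => /leq_trans/(_ (leq_add ai bj)).
by rewrite ltnNge leqnSn.
Qed.

HB.instance Definition _ :=
  GRing.ComUnitRing_isIntegral.Build Zp padic_idomain.

Definition padic_ball x (k : nat) : set Zp := [set y | residue y k = residue x k].

Definition padic_open : set_system Zp :=
  [set A | forall x, A x -> exists k, padic_ball x k `<=` A].

Fact padic_ball_le x k l : (k <= l)%N -> padic_ball x l `<=` padic_ball x k.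
Proof.
move=> /subnKC <-; elim: (l - k)%N => [|j IHj]; first by rewrite addn0.
move=> y; rewrite addnS => yx; apply: IHj; rewrite /padic_ball /=.
by rewrite -[LHS]residueP -[RHS]residueP yx.
Qed.

Fact padic_openT : padic_open setT.
Proof. by move=> x _; exists 0%N. Qed.

Fact padic_openI : setI_closed padic_open.
Proof.
move=> A B oA oB x [/oA[k xA] /oB[l xB]]; exists (maxn k l) => y yx; split.
  by apply: xA; apply: padic_ball_le yx; rewrite leq_maxl.
by apply: xB; apply: padic_ball_le yx; rewrite leq_maxr.
Qed.

Fact padic_open_bigU (I : Type) (f : I -> set Zp) :
  (forall i, padic_open (f i)) -> padic_open (\bigcup_i f i).
Proof.
move=> of_ x [i _ /of_[k xk]]; exists k => y /xk fy; by exists i.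
Qed.

HB.instance Definition _ := isPointed.Build Zp 0.
HB.instance Definition _ :=
  isOpenTopological.Build Zp padic_openT padic_openI padic_open_bigU.

Definition padic_dvd (d x : Zp) := exists c, x = c * d.

(* The relation v_p(x) = k; it holds for no k when x = 0.  *)
Definition padic_val x (k : nat) :=
  padic_dvd (p%:R ^+ k) x /\ ~ padic_dvd (p%:R ^+ k.+1) x.

End PadicRing.

Section Orders.
Variables (S : idomainType) (A : algType {fraction S}).

(* A subring of A which is finitely generated as an S-module and which spans  *)
(* A over the fraction field of S.                                            *)
Definition is_order (O : set A) :=
  [/\ subring_closed (mem O),
      exists (m : nat) (g : 'I_m -> A),
        O = [set \sum_(i < m) tofrac (c i) *: g i | c in [set: 'I_m -> S]]
    & forall a, exists2 d : S, d != 0 & O (tofrac d *: a)].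

(* Maximality is with respect to inclusion.  When A is commutative there is   *)
(* at most one such O, since the product of two orders is then an order.      *)
Definition is_maximal_order (O : set A) :=
  is_order O /\ forall O' : set A, is_order O' -> O `<=` O' -> O' = O.

End Orders.

Section MonicPolynomials.
Variable S : idomainType.

(* The tuple (a_1, ..., a_n) is indexed from 0, so a_i is a 0 (i - 1).  *)
Definition monic_poly n (a : 'rV[S]_n) : {poly S} :=
  'X^n + \sum_(i < n) a 0 i *: 'X^(n - i.+1).

(* This is the discriminant for f monic and S of characteristic 0: the        *)
(* Sylvester matrix in the library is sized by the actual degree of f'.       *)
Definition disc (f : {poly S}) : S :=
  (-1) ^+ 'C((size f).-1, 2) * resultant f f^`().

Definition poly_frac (f : {poly S}) : {poly {fraction S}} :=
  map_poly (@tofrac S) f.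

(* S[x]/(f) inside Frac(S)[x]/(f), for f monic of positive degree.  (In this  *)
(* case S[x] meets the ideal (f) of Frac(S)[x] in the ideal (f) of S[x].)     *)
Definition equation_order (f : {poly S}) : set {poly %/ poly_frac f} :=
  [set in_qpoly (poly_frac f) (poly_frac g) | g in [set: {poly S}]].

End MonicPolynomials.

Section Densities.
Variables (R : realType) (p : nat) (pr_p : prime p) (n : nat).
Local Notation V := 'rV[padic_int pr_p]_n.

Definition borel_rV := g_sigma_algebraType (@open V).

(* The total mass is only required to be positive and finite; densities do    *)
(* not depend on the normalization.                                           *)
Definition is_haar (mu : {measure set borel_rV -> \bar R}) :=
  [/\ (0 < mu [set: V])%E, (mu [set: V] < +oo)%E &
      forall (v : V) (A : set borel_rV), measurable A ->
        mu [set v + a | a in (A : set V)] = mu A].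

Variable mu : {measure set borel_rV -> \bar R}.

Definition density (W A : set V) : R := fine (mu (W `&` A)) / fine (mu W).

Definition P_max (W : set V) : R :=
  density W [set a | is_maximal_order (@equation_order _ (monic_poly a))].

Definition P0_sqf (W : set V) : R :=
  density W [set a | ~ padic_dvd p%:R (disc (monic_poly a))].

Definition P1_sqf (W : set V) : R :=
  density W [set a | padic_val (disc (monic_poly a)) 1].

(* The coefficient a_n of x^0 is not divisible by p.  *)
Definition unit_const : set V := [set a | ~ padic_dvd p%:R (monic_poly a)`_0].

End Densities.

Arguments unit_const {p} pr_p n.

(* Main.v *)
(** Write the reduction of f modulo p as r^2 h with h squarefree, and
    f = R^2 H + p U where R and H are the naive lifts of r and h.  The pair
    formed by f mod p and u = U mod p determines f modulo p^2, and conversely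
    all such pairs have the same Haar measure.  In these terms

    - Z_p[x]/(f) is maximal iff r and u are coprime (Dedekind's criterion);
    - p does not divide Disc f iff r = 1;
    - v_p(Disc f) = 1 iff deg r = 1 and r is coprime to 2 h u.

    The last two follow from the Sylvester matrix of f and f': when r <> 1 one
    can make a row divisible by p by a unimodular row operation, and the
    remaining determinant is studied modulo p.

    It remains to count pairs over F_p.  Let N k be the number of monic
    polynomials of degree k not vanishing at 0.  Unique factorization of f as
    d^2 h gives N n = sum_k N k S (n - 2k) for the number S of squarefree ones,
    and dividing r and u by their gcd d gives
    p^n N n = sum_k N k p^k W (n - 2k) for the number W of coprime pairs.  These
    recurrences have the stated closed forms.  For v_p(Disc f) = 1 one counts
    squarefree h not vanishing at a given c <> 0, through
    S (n + 1) = Q (n + 1) + Q n. *)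

Require Import Defs.
From HB Require Import structures.
From mathcomp Require Import all_boot all_order all_algebra all_field.
From mathcomp Require Import all_classical all_reals all_analysis.
From mathcomp Require Import zify ring.

Set Implicit Arguments.
Unset Strict Implicit.
Unset Printing Implicit Defensive.

Import Order.TTheory GRing.Theory Num.Theory.

Local Open Scope ring_scope.

(** * Square parts of polynomials over a finite field *)

(** The closed forms can be read off generating series. With q = p and N(t) = (1 - t)/(1 - qt) for
    the numbers N k, the recurrences say S(t) = N(t)/N(t^2) = (1 - qt^2)/((1 - qt)(1 + t)), Q(t) =
    S(t)/(1 + t) and W(t) = N(qt)/N(qt^2). The pole t = -1 of S produces (-1)^n, its doubling in Q
    the factor n - 1, and the poles t^2 = 1/q of W the term of order p^(-3n/2) that depends on the
    parity of n. The weight p^k in the recurrence for W counts the multiples of f/d^2 that may be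
    added to u/d without changing its gcd with r/d.

    The factor 2 in the condition for v_p = 1 comes from (r^2 h)' = r (2 r' h + r h'); it makes p =
    2 exceptional. Two difficulties shape the algebra: f' may lose degree modulo p, so Sylvester
    matrices get a prescribed size; and maximality is tested against an arbitrary larger order,
    inside which one computes modulo p. *)

Section MonicVectors.
Variable S : idomainType.

Lemma coef_monic_poly n (a : 'rV[S]_n) (i : 'I_n) :
  (monic_poly a)`_(n - i.+1) = a 0 i.
Proof.
rewrite coefD coefXn coef_sum (bigD1 i) //= coefZ coefXn eqxx mulr1 big1 => [|j].
  rewrite addr0; case: eqP => [e|]; last by rewrite add0r.
  by have := ltn_ord i; move: e; lia.
rewrite coefZ coefXn eq_sym => ji; case: eqP; rewrite ?mulr0 // => e.
by case/eqP: ji; apply: ord_inj; have := ltn_ord i; have := ltn_ord j; lia.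
Qed.

Lemma size_monic_poly_tail n (a : 'rV[S]_n) :
  (size (\sum_(i < n) a 0 i *: 'X^(n - i.+1) : {poly S})%R <= n)%N.
Proof.
apply: (leq_trans (size_sum _ _ _)); apply/bigmax_leqP => i _.
apply: (leq_trans (size_scale_leq _ _)); rewrite size_polyXn.
by have := ltn_ord i; lia.
Qed.

Lemma size_monic_poly n (a : 'rV[S]_n) : size (monic_poly a) = n.+1.
Proof.
by rewrite /monic_poly size_polyDl size_polyXn // ltnS size_monic_poly_tail.
Qed.

Lemma monic_polyP n (a : 'rV[S]_n) : monic_poly a \is monic.
Proof.
rewrite monicE /lead_coef size_monic_poly coefD coefXn eqxx /=.
by rewrite [X in _ + X]nth_default ?addr0 // size_monic_poly_tail.
Qed.

Definition coef_rV n (f : {poly S}) : 'rV[S]_n := \row_i f`_(n - i.+1).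

Lemma monic_polyK n : cancel (@monic_poly S n) (coef_rV n).
Proof. by move=> a; apply/rowP => i; rewrite mxE coef_monic_poly. Qed.

Lemma coef_rVK n (f : {poly S}) : f \is monic -> size f = n.+1 ->
  monic_poly (coef_rV n f) = f.
Proof.
move=> mf sf; apply/polyP => i; have [ltin|] := ltnP i n.
  have ltj : (n - i.+1 < n)%N by lia.
  have ei : i = (n - (Ordinal ltj).+1)%N by rewrite /=; lia.
  by rewrite [i in LHS]ei coef_monic_poly mxE -ei.
rewrite leq_eqVlt => /predU1P[<-|ltni].
  have := mf; have := monic_polyP (coef_rV n f).
  by rewrite !monicE /lead_coef size_monic_poly sf => /eqP -> /eqP ->.
by rewrite !nth_default ?size_monic_poly ?sf.
Qed.

End MonicVectors.

Lemma monic_poly_inj (S : idomainType) n : injective (@monic_poly S n).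
Proof. exact: can_inj (@monic_polyK S n). Qed.

Lemma monic_size2 (S : nzRingType) (r : {poly S}) :
  r \is monic -> size r = 2%N -> r = 'X - (- r`_0)%:P.
Proof.
move=> mr s2; apply/polyP => -[|[|i]]; rewrite coefB coefX coefC /= ?subr0 ?sub0r.
- by rewrite opprK.
- by move: mr; rewrite monicE lead_coefE s2 => /eqP.
- by rewrite nth_default // s2.
Qed.

Lemma size_sqr_mul (S : idomainType) (r h : {poly S}) :
  r \is monic -> h \is monic -> size (r ^+ 2 * h) = ((size r).-1.*2 + size h)%N.
Proof.
move=> mr mh; rewrite mulrC size_Mmonic ?monic_neq0 ?monic_exp //.
have := size_exp r 2; have : (0 < size h)%N by rewrite size_poly_gt0 monic_neq0.
have : (0 < size (r ^+ 2))%N by rewrite size_poly_gt0 monic_neq0 ?monic_exp.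
by move: (size (r ^+ 2)) (size r) (size h); lia.
Qed.

Section SquarePart.
Variables (F : finFieldType).
Implicit Types f g h r s u v : {poly F}.

(** Only exponents divisible by p survive, and the Frobenius of a finite field is onto, so the
    coefficients have p-th roots. This perfectness makes separable and squarefree equivalent
    below. *)
Lemma deriv_eq0_exp p u : p \in [pchar F] -> u^`() = 0 -> exists v, u = v ^+ p.
Proof.
move=> charFp u'0; have p_gt0 := prime_gt0 (pcharf_prime charFp).
have [g gK Kg] := injF_bij (fmorph_inj (pFrobenius_aut charFp)).
have charP : p \in [pchar {poly F}] by rewrite pchar_poly.
exists (\poly_(i < size u) g u`_(p * i)).
rewrite -(pFrobenius_autE charP) poly_def rmorph_sum /=.
under eq_bigr => i _ do
  rewrite pFrobenius_autE exprZn -(pFrobenius_autE charFp) Kg -exprM (mulnC i).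
apply/polyP => j; rewrite coef_sum.
have [/dvdnP[k ->]|ndvd] := boolP (p %| j)%N.
  under eq_bigr => i _ do
    rewrite coefZ coefXn (mulnC k) eqn_pmul2l // eq_sym mulr_natr mulrb.
  have [ltk|lek] := ltnP k (size u).
    by rewrite -big_mkcond (big_pred1 (Ordinal ltk)) /= 1?mulnC.
  rewrite big1 => [|i _].
    by rewrite nth_default // (leq_trans lek) ?leq_pmulr.
  by case: eqP => // e; move: lek; rewrite -e leqNgt ltn_ord.
rewrite big1 => [|i _]; last first.
  rewrite coefZ coefXn; case: eqP => [e|]; rewrite ?mulr0 //.
  by rewrite e dvdn_mulr in ndvd.
case: j ndvd => [|j ndvd]; first by rewrite dvdn0.
have /eqP := congr1 (fun f => f`_j) u'0.
rewrite coef_deriv coef0 -mulr_natr mulf_eq0 => /orP[/eqP->//|].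
by rewrite -(dvdn_pcharf charFp) (negPf ndvd).
Qed.

Lemma separable_squareP f :
  separable_poly f <-> forall s, size s != 1%N -> ~~ (s ^+ 2 %| f).
Proof.
split=> [/separable_polyP[sq _]|sq]; first exact/poly_square_freeP.
apply/separable_polyP; split=> [|u uf u1]; first exact/poly_square_freeP.
have [p pr_p charFp] := finPcharP F.
apply/eqP => /(deriv_eq0_exp charFp)[v uE]; have /sq/negP : size v != 1%N.
  apply: contraL u1 => /eqP/eq_leq/size1_polyC v1.
  by rewrite uE v1 -polyC_exp -leqNgt size_polyC_leq1.
by apply; apply: dvdp_trans uf; rewrite uE dvdp_exp2l ?prime_gt1.
Qed.

Lemma square_decomposition_exists f : f \is monic ->
  exists r h, [/\ r \is monic, h \is monic, separable_poly h & f = r ^+ 2 * h].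
Proof.
have [n] := ubnP (size f); elim: n f => // n IHn f sf mf.
have [sep|/negP nsep] := boolP (separable_poly f).
  by exists 1, f; rewrite monic1 expr1n mul1r.
have /existsNP[s /not_implyP[s1 /negP/negPn s2f]] :
  ~ forall s, size s != 1%N -> ~~ (s ^+ 2 %| f) by move/separable_squareP.
have f0 := monic_neq0 mf; have s0 : s != 0.
  by apply: contraTneq s2f => ->; rewrite expr0n dvd0p.
have lc0 : lead_coef s != 0 by rewrite lead_coef_eq0.
pose t : {poly F} := (lead_coef s)^-1 *: s.
have mt : t \is monic by rewrite monicE lead_coefZ mulVf.
have /dvdpP[k fE] : t ^+ 2 %| f by rewrite exprZn dvdpZl ?expf_neq0 ?invr_eq0.
have mk : k \is monic by rewrite -(monicMr _ (monic_exp 2 mt)) -fE.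
have [|r [h [mr mh seph kE]]] := IHn k _ mk.
  rewrite -ltnS (leq_trans _ sf) // fE size_Mmonic ?monic_neq0 ?monic_exp //.
  have t1 : (1 < size t)%N.
    by rewrite ltn_neqAle eq_sym size_poly_gt0 monic_neq0 // size_scale ?invr_eq0 ?s1.
  have := size_exp t 2; have : (0 < size k)%N by rewrite size_poly_gt0 monic_neq0.
  have : (0 < size (t ^+ 2))%N by rewrite size_poly_gt0 monic_neq0 ?monic_exp.
  move: t1; move: (size k) (size (t ^+ 2)) (size t); lia.
exists (t * r), h; split=> //; first by rewrite monicMl.
by rewrite fE kE exprMn; ring.
Qed.

(** Divide r and r' by their gcd: the cofactors s and t are coprime, so s^2 divides h', which is
    squarefree; hence s is constant and r divides r'. By symmetry the two monic polynomials
    agree. *)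
Lemma square_decomposition_unique r r' h h' :
  r \is monic -> r' \is monic -> separable_poly h -> separable_poly h' ->
  r ^+ 2 * h = r' ^+ 2 * h' -> r = r'.
Proof.
move=> mr mr' sh sh' E; apply/eqP; rewrite -eqp_monic //.
suff key (a b k l : {poly F}) : a \is monic -> b \is monic -> separable_poly l ->
    a ^+ 2 * k = b ^+ 2 * l -> a %| b.
  by rewrite /eqp (key r r' h h') // (key r' r h' h).
move=> ma mb /separable_squareP sl abE; pose g := gcdp a b.
have g0 : g != 0 by rewrite gcdp_eq0 negb_and monic_neq0.
have /dvdpP[s aE] : g %| a by rewrite dvdp_gcdl.
have /dvdpP[t bE] : g %| b by rewrite dvdp_gcdr.
have cst : coprimep s t.
  rewrite -(mulpK s g0) -(mulpK t g0) -aE -bE.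
  by apply: coprimep_div_gcd; rewrite monic_neq0.
have : s ^+ 2 %| l.
  rewrite -(@Gauss_dvdpr _ _ (t ^+ 2)) ?coprimep_expl ?coprimep_expr //.
  apply/dvdpP; exists k; apply: (mulfI (expf_neq0 2 g0)).
  by move: abE; rewrite aE bE => abE; ring: abE.
move=> s2l; have s1 : size s = 1%N.
  by apply: contraTeq s2l; apply: sl.
rewrite aE bE; have [c c0 ->] : exists2 c, c != 0 & s = c%:P.
  by apply/size_poly1P/eqP.
by rewrite mul_polyC dvdpZl // dvdp_mull.
Qed.

(** For monic f the set is a singleton by the two preceding lemmas; the default 1 only serves other
    f. *)
Definition sqrt_part f : {poly F} :=
  xget 1 [set r | exists h, [/\ r \is monic, h \is monic, separable_poly h
                             & f = r ^+ 2 * h]]%classic.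

Definition sqfree_part f : {poly F} := f %/ sqrt_part f ^+ 2.

Lemma sqrt_part_spec f : f \is monic ->
  [/\ sqrt_part f \is monic, sqfree_part f \is monic,
      separable_poly (sqfree_part f) & f = sqrt_part f ^+ 2 * sqfree_part f].
Proof.
move=> mf; have [h [mr mh sh fE]] :=
  xgetPex 1 (square_decomposition_exists mf).
rewrite -/(sqrt_part f) in mr fE.
have hE : sqfree_part f = h.
  by rewrite /sqfree_part {1}fE mulKp // expf_neq0 // monic_neq0.
by rewrite hE.
Qed.

Lemma sqrt_partE r h : r \is monic -> h \is monic -> separable_poly h ->
  sqrt_part (r ^+ 2 * h) = r.
Proof.
move=> mr mh sh; have [|mr' _ sh' E] := @sqrt_part_spec (r ^+ 2 * h).
  by rewrite monicMl ?monic_exp.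
by apply: esym; apply: square_decomposition_unique E.
Qed.

Lemma sqfree_partE r h : r \is monic -> h \is monic -> separable_poly h ->
  sqfree_part (r ^+ 2 * h) = h.
Proof.
by move=> mr mh sh; rewrite /sqfree_part sqrt_partE // mulKp // expf_neq0 ?monic_neq0.
Qed.

End SquarePart.

(** * Counting over a finite field *)

Lemma card_sum_fibers (T J : finType) (A : {set T}) (f : T -> J) :
  #|A| = (\sum_j #|[set x in A | f x == j]|)%N.
Proof.
rewrite -sum1_card (partition_big f xpredT) //=; apply: eq_bigr => j _.
by rewrite -sum1_card; apply: eq_bigl => x; rewrite inE.
Qed.

Lemma eqp_monic_gcd (F : fieldType) (a b : {poly F}) : a != 0 ->
  exists d, [/\ d \is monic, d %| a & gcdp a b %= d].
Proof.
move=> a0; have g0 : gcdp a b != 0 by rewrite gcdp_eq0 negb_and a0.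
have lc0 : (lead_coef (gcdp a b))^-1 != 0 by rewrite invr_eq0 lead_coef_eq0.
exists ((lead_coef (gcdp a b))^-1 *: gcdp a b).
rewrite monicE lead_coefZ mulVf ?lead_coef_eq0 // dvdpZl // dvdp_gcdl.
by rewrite eqp_sym eqp_scale.
Qed.

Section Counting.
Variables (F : finFieldType).
Local Notation q := #|F|.

(** The cardinals of [const_neq0 n], [sqfree_rV n], [sqfree_rV_at c n] and [coprime_pairs n] are the
    N n, S n, Q n and W n of the recurrences. *)
Definition const_neq0 n := [set x : 'rV[F]_n | (monic_poly x)`_0 != 0].

Definition sqfree_rV n := [set x in const_neq0 n | separable_poly (monic_poly x)].

Definition sqfree_rV_at c n := [set x in sqfree_rV n | ~~ root (monic_poly x) c].

Definition coprime_pairs n := [set xu : 'rV[F]_n * 'rV[F]_n |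
  (xu.1 \in const_neq0 n) && coprimep (sqrt_part (monic_poly xu.1)) (rVpoly xu.2)].

(** The factor 2 of the criterion for v_p = 1 is left out: it is a unit when p is odd, the only case
    where these pairs are counted. *)
Definition simple_pairs n := [set xu : 'rV[F]_n * 'rV[F]_n |
  [&& xu.1 \in const_neq0 n, size (sqrt_part (monic_poly xu.1)) == 2%N
    & coprimep (sqrt_part (monic_poly xu.1))
               (sqfree_part (monic_poly xu.1) * rVpoly xu.2)]].

Lemma monic_poly0 (x : 'rV[F]_0) : monic_poly x = 1.
Proof. by rewrite /monic_poly big_ord0 addr0. Qed.

Lemma card_rV n : #|{: 'rV[F]_n}| = (q ^ n)%N.
Proof. by rewrite card_mx mul1n. Qed.

Lemma card_const_neq00 : #|const_neq0 0| = 1%N.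
Proof.
rewrite (_ : const_neq0 0 = finset.setT) ?cardsT ?card_rV //.
by apply/setP => x; rewrite !inE monic_poly0 coef1 oner_eq0.
Qed.

Definition adjoin_root c n (y : 'rV[F]_n) :=
  coef_rV n.+1 (monic_poly y * ('X - c%:P)).

Lemma adjoin_rootE c n (y : 'rV[F]_n) :
  monic_poly (adjoin_root c y) = monic_poly y * ('X - c%:P).
Proof.
rewrite coef_rVK ?monicMl ?monic_polyP ?monicXsubC //.
by rewrite size_Mmonic ?monic_neq0 ?monic_polyP ?monicXsubC // size_monic_poly
  size_XsubC addn2.
Qed.

Lemma adjoin_root_inj c n : injective (@adjoin_root c n).
Proof.
move=> y z /(congr1 (@monic_poly _ _)); rewrite !adjoin_rootE => /mulIf.
by rewrite polyXsubC_eq0 => /(_ isT)/monic_poly_inj.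
Qed.

(** Division by X - c is a bijection onto [A]. It is applied with c = 0 to count vanishing constant
    terms, and with c <> 0 to squarefree polynomials. *)
Lemma imset_adjoin_root c n (A : {set 'rV[F]_n}) (B : {set 'rV[F]_n.+1}) :
  (forall y, (adjoin_root c y \in B) = (y \in A)) ->
  #|[set x in B | root (monic_poly x) c]| = #|A|.
Proof.
move=> BA; rewrite -(card_imset _ (@adjoin_root_inj c n)); apply/eq_card => x.
rewrite inE; apply/andP/imsetP => [[xB]|[y yA ->]]; last first.
  by rewrite BA yA adjoin_rootE rootM root_XsubC eqxx orbT.
rewrite root_factor_theorem => /dvdpP[g gE].
have mg : g \is monic by rewrite -(monicMr _ (monicXsubC c)) -gE monic_polyP.
suff xE : x = adjoin_root c (coef_rV n g).
  by exists (coef_rV n g) => //; rewrite -BA -xE.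
apply: monic_poly_inj; rewrite adjoin_rootE coef_rVK //.
have := congr1 (size : {poly F} -> nat) gE.
rewrite size_monic_poly size_Mmonic ?monic_neq0 ?monicXsubC // size_XsubC addn2.
by case.
Qed.

Lemma card_const_neq0S n : (#|const_neq0 n.+1| + q ^ n = q ^ n.+1)%N.
Proof.
rewrite -(card_rV n.+1) -(cardsC (const_neq0 n.+1)); congr addn.
rewrite -card_rV -cardsT -(@imset_adjoin_root 0 _ _ finset.setT) => [|y].
  by apply: eq_card => x; rewrite !inE negbK rootE -horner_coef0.
by rewrite !inE.
Qed.

Lemma coef0_sqr_mul (r h : {poly F}) :
  ((r ^+ 2 * h)`_0 != 0) = (r`_0 != 0) && (h`_0 != 0).
Proof. by rewrite expr2 !coef0M !mulf_eq0 !negb_or andbb. Qed.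

(** Existence and uniqueness of the square part make (r, h) |-> r^2 h a bijection from pairs of
    degrees k and m. *)
Lemma card_const_neq0_part n k m : n = (k.*2 + m)%N ->
  #|[set x in const_neq0 n | size (sqrt_part (monic_poly x)) == k.+1]| =
  (#|const_neq0 k| * #|sqfree_rV m|)%N.
Proof.
move=> nE; rewrite -cardsX.
pose f (z : 'rV[F]_k * 'rV[F]_m) := coef_rV n (monic_poly z.1 ^+ 2 * monic_poly z.2).
have fE z : monic_poly (f z) = monic_poly z.1 ^+ 2 * monic_poly z.2.
  rewrite coef_rVK ?monicMl ?monic_exp ?monic_polyP //.
  by rewrite size_sqr_mul ?monic_polyP // !size_monic_poly nE addnS.
have finj : {in finset.setX (const_neq0 k) (sqfree_rV m) &, injective f}.
  move=> [r h] [r' h']; rewrite !inE /= => /and3P[_ _ sh] /and3P[_ _ sh'].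
  move=> /(congr1 (@monic_poly _ _)); rewrite !fE /= => E.
  have := congr1 (@sqrt_part F) E; have := congr1 (@sqfree_part F) E.
  rewrite !sqrt_partE ?sqfree_partE ?monic_polyP //.
  by move=> /monic_poly_inj -> /monic_poly_inj ->.
rewrite -(card_in_imset finj); apply/eq_card => x; rewrite !inE.
apply/andP/imsetP => [[x0 /eqP sr]|[[r h]]]; last first.
  rewrite !inE /= => /and3P[r0 h0 sh] ->; rewrite fE /= coef0_sqr_mul r0 h0.
  by rewrite sqrt_partE ?monic_polyP // size_monic_poly.
have [mr mh sh xE] := sqrt_part_spec (monic_polyP x).
move: (sqrt_part _) (sqfree_part _) mr mh sh xE sr => r h mr mh sh xE sr.
have sz : size h = m.+1.
  have := congr1 (size : {poly F} -> nat) xE.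
  by rewrite size_monic_poly size_sqr_mul // sr nE -addnS => /addnI.
move: x0; rewrite xE coef0_sqr_mul => /andP[r0 h0].
exists (coef_rV k r, coef_rV m h); first by rewrite !inE /= !coef_rVK // r0 h0.
by apply: monic_poly_inj; rewrite fE /= !coef_rVK.
Qed.

Lemma size_sqrt_part_le n (x : 'rV[F]_n) :
  ((size (sqrt_part (monic_poly x))).-1 < n./2.+1)%N.
Proof.
have [mr mh _ xE] := sqrt_part_spec (monic_polyP x).
have := congr1 (size : {poly F} -> nat) xE; rewrite size_monic_poly size_sqr_mul //.
have : (0 < size (sqfree_part (monic_poly x)))%N by rewrite size_poly_gt0 monic_neq0.
by move: (size (sqrt_part _)) (size (sqfree_part _)); lia.
Qed.

Lemma card_const_neq0_rec n : #|const_neq0 n| =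
  (\sum_(k < n./2.+1) #|const_neq0 k| * #|sqfree_rV (n - k.*2)|)%N.
Proof.
rewrite (card_sum_fibers _ (fun x => Ordinal (size_sqrt_part_le x))).
apply: eq_bigr => k _; rewrite -(@card_const_neq0_part n); last first.
  by have := ltn_ord k; lia.
apply: eq_card => x; rewrite !inE; congr andb.
have [mr _ _ _] := sqrt_part_spec (monic_polyP x).
have : (0 < size (sqrt_part (monic_poly x)))%N by rewrite size_poly_gt0 monic_neq0.
by rewrite -val_eqE /=; case: size.
Qed.

Lemma gcdp_mul_coprime (d r u : {poly F}) : coprimep r u ->
  gcdp (d * r) (d * u) %= d.
Proof.
rewrite -gcdp_eqp1 => cru; apply: eqp_trans (gcdp_mul2l _ _ _) _.
by rewrite -[X in _ %= X]mulr1 eqp_mull.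
Qed.

(** If d is the gcd, then f = d^2 x and u = d u'. Only u' modulo x matters for coprimality, since
    the square part of x divides x; the quotient of u' by x is free and accounts for q^k. *)
Lemma card_gcd_sqrt_part n k m : n = (k.*2 + m)%N ->
  #|[set xu : 'rV[F]_n * 'rV[F]_n | (xu.1 \in const_neq0 n) &&
     (size (gcdp (sqrt_part (monic_poly xu.1)) (rVpoly xu.2)) == k.+1)]| =
  (#|const_neq0 k| * q ^ k * #|coprime_pairs m|)%N.
Proof.
move=> nE; rewrite -card_rV -cardsT -!cardsX.
(* The data are d, the quotient e, then x and the remainder s: they are sent to (d^2 x, d (e x +
   s)). *)
pose f (z : 'rV[F]_k * 'rV[F]_k * ('rV[F]_m * 'rV[F]_m)) :=
  (coef_rV n (monic_poly z.1.1 ^+ 2 * monic_poly z.2.1),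
   poly_rV (monic_poly z.1.1 * (rVpoly z.1.2 * monic_poly z.2.1 + rVpoly z.2.2)) : 'rV[F]_n).
have f1E z : monic_poly (f z).1 = monic_poly z.1.1 ^+ 2 * monic_poly z.2.1.
  rewrite coef_rVK ?monicMl ?monic_exp ?monic_polyP //.
  by rewrite size_sqr_mul ?monic_polyP // !size_monic_poly nE addnS.
have f2E z : rVpoly (f z).2 =
    monic_poly z.1.1 * (rVpoly z.1.2 * monic_poly z.2.1 + rVpoly z.2.2).
  rewrite poly_rV_K // (leq_trans (size_polyMleq _ _)) // size_monic_poly /=.
  rewrite nE -addnn -addnA leq_add2l (leq_trans (size_polyD _ _)) // geq_max.
  rewrite (leq_trans (size_poly _ _)) ?leq_addl // andbT.
  rewrite (leq_trans (size_polyMleq _ _)) // size_monic_poly addnS /= leq_add2r.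
  exact: size_poly.
have sqE z : sqrt_part (monic_poly (f z).1) = monic_poly z.1.1 * sqrt_part (monic_poly z.2.1).
  have [mr mh sh xE] := sqrt_part_spec (monic_polyP z.2.1).
  by rewrite f1E {1}xE mulrA -exprMn sqrt_partE ?monicMl ?monic_polyP.
have gE z : z.2 \in coprime_pairs m ->
  gcdp (sqrt_part (monic_poly (f z).1)) (rVpoly (f z).2) %= monic_poly z.1.1.
  rewrite inE => /andP[_ cop]; rewrite sqE f2E gcdp_mul_coprime //.
  have [mr mh sh xE] := sqrt_part_spec (monic_polyP z.2.1).
  (* x is a multiple of its square part, so e x drops out of the gcd. *)
  rewrite [X in rVpoly _ * X](_ : _ = sqfree_part (monic_poly z.2.1) *
    sqrt_part (monic_poly z.2.1) * sqrt_part (monic_poly z.2.1)).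
    by rewrite !mulrA coprimep_addl_mul.
  by rewrite {1}xE; ring.
have finj : {in finset.setX (finset.setX (const_neq0 k) finset.setT)
                 (coprime_pairs m) &, injective f}.
  move=> [z1 z2] [z1' z2'] /finset.setXP[_ cz] /finset.setXP[_ cz'] E.
  pose z := (z1, z2); pose z' := (z1', z2').
  have d0 := monic_neq0 (monic_polyP z.1.1).
  have Ed : z.1.1 = z'.1.1.
    apply: monic_poly_inj; apply/eqP; rewrite -eqp_monic ?monic_polyP //.
    by rewrite -(eqp_ltrans (gE z cz)) /z E gE.
  have Ex : z.2.1 = z'.2.1.
    apply: monic_poly_inj; apply: (mulfI (expf_neq0 2 d0)).
    by rewrite -[LHS]f1E E f1E Ed.
  have : rVpoly z.1.2 * monic_poly z.2.1 + rVpoly z.2.2 =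
    rVpoly z'.1.2 * monic_poly z.2.1 + rVpoly z'.2.2.
    by apply: (mulfI d0); rewrite -[LHS]f2E E f2E Ed Ex.
  have ltm (y : 'rV[F]_m) : (size (rVpoly y) < size (monic_poly z.2.1))%N.
    by rewrite size_monic_poly ltnS size_poly.
  move=> /divp_modpP/(_ (ltm _)).
  rewrite divp_addl_mul_small // modp_addl_mul_small //.
  case=> /(can_inj rVpolyK) Eq /(can_inj rVpolyK) Es.
  move: Ed Ex Eq Es => {E cz cz' d0 ltm}; rewrite {}/z {}/z'.
  by case: z1 z1' z2 z2' => [d e] [d' e'] [x s] [x' s'] /= -> -> -> ->.
rewrite -(card_in_imset finj); apply/eq_card => xu; rewrite inE.
apply/andP/imsetP => [[x0 /eqP sg]|[z]]; last first.
  case: z => -[d e] z2 /finset.setXP[/finset.setXP[z0 _] cz] ->.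
  rewrite (eqp_size (gE (_, _) cz)) size_monic_poly eqxx inE f1E coef0_sqr_mul.
  by split=> //; move: cz z0; rewrite !inE => /andP[-> _] ->.
have [mr mh sh xE] := sqrt_part_spec (monic_polyP xu.1).
have [d [md /dvdpP[r rE] gd]] := eqp_monic_gcd (rVpoly xu.2) (monic_neq0 mr).
have /dvdpP[u uE] : d %| rVpoly xu.2 by rewrite -(eqp_dvdl _ gd) dvdp_gcdr.
have sd : size d = k.+1 by rewrite -(eqp_size gd).
move: x0; rewrite inE xE coef0_sqr_mul => /andP[r0 h0].
move: (sqfree_part _) mh sh xE h0 rE gd => h mh sh xE h0 rE gd.
have mr' : r \is monic by rewrite -(monicMr _ md) -rE.
pose x := r ^+ 2 * h; have mx : x \is monic by rewrite monicMl ?monic_exp.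
have xE' : monic_poly xu.1 = d ^+ 2 * x by rewrite xE rE /x; ring.
have sx : size x = m.+1.
  have := congr1 (size : {poly F} -> nat) xE'.
  by rewrite size_monic_poly size_sqr_mul // sd nE -addnS => /addnI.
(* Here u is the cofactor of d: it has size at most n - k = k + m, and x has degree m. *)
have su : (size (u %/ x)%R <= k)%N.
  rewrite size_divp ?monic_neq0 // sx /= leq_subLR.
  have [->|u0] := eqVneq u 0; first by rewrite size_poly0.
  have : (size (rVpoly xu.2) <= n)%N by apply: size_poly.
  rewrite uE size_Mmonic // sd nE; move: (size u); lia.
have sr : (size (u %% x)%R <= m)%N by rewrite -ltnS -sx ltn_modp monic_neq0.
have zE : xu = f (coef_rV k d, poly_rV (u %/ x), (coef_rV m x, poly_rV (u %% x))).
  transitivity (xu.1, xu.2); first by case: (xu).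
  rewrite /f /= !coef_rVK // !poly_rV_K // -xE'.
  by rewrite monic_polyK -divp_eq mulrC -uE rVpolyK.
exists (coef_rV k d, poly_rV (u %/ x), (coef_rV m x, poly_rV (u %% x))) => //.
have d0 : d`_0 != 0 by move: r0; rewrite rE coef0M mulf_eq0 negb_or => /andP[].
have r'0 : r`_0 != 0 by move: r0; rewrite rE coef0M mulf_eq0 negb_or => /andP[].
rewrite !inE /= !coef_rVK // d0 coef0_sqr_mul r'0 h0 poly_rV_K // sqrt_partE //.
have : gcdp (d * r) (d * u) %= d.
  by rewrite (mulrC d r) -rE (mulrC d u) -uE.
rewrite (eqp_ltrans (gcdp_mul2l _ _ _)) -[X in _ %= X]mulr1 eqp_mul2l ?monic_neq0 //.
rewrite gcdp_eqp1 {1}[u](divp_eq u x).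
by rewrite [X in _ %/ _ * X](_ : x = r * h * r) ?mulrA ?coprimep_addl_mul // /x; ring.
Qed.

Lemma card_coprime_pairs_rec n : (q ^ n * #|const_neq0 n| =
  \sum_(k < n./2.+1) #|const_neq0 k| * q ^ k * #|coprime_pairs (n - k.*2)|)%N.
Proof.
rewrite mulnC -card_rV -cardsT -cardsX.
have g0 xu : gcdp (sqrt_part (monic_poly xu.1)) (rVpoly xu.2) != 0
    :> {poly F} by move=> *; rewrite gcdp_eq0 negb_and monic_neq0 //;
    have [] := sqrt_part_spec (monic_polyP xu.1).
have ltg (xu : 'rV[F]_n * 'rV[F]_n) :
    ((size (gcdp (sqrt_part (monic_poly xu.1)) (rVpoly xu.2))).-1 < n./2.+1)%N.
  apply: leq_ltn_trans (size_sqrt_part_le xu.1).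
  have [mr _ _ _] := sqrt_part_spec (monic_polyP xu.1).
  have := dvdp_leq (monic_neq0 mr) (dvdp_gcdl _ (rVpoly xu.2)).
  by move: (size _) (size (sqrt_part _)); lia.
rewrite (card_sum_fibers _ (fun xu => Ordinal (ltg xu))).
apply: eq_bigr => k _; rewrite -(@card_gcd_sqrt_part n); last first.
  by have := ltn_ord k; lia.
apply: eq_card => -[x u]; rewrite !inE /= andbT; congr andb.
have [mr _ _ _] := sqrt_part_spec (monic_polyP x).
have : (0 < size (gcdp (sqrt_part (monic_poly x)) (rVpoly u)))%N.
  by rewrite size_poly_gt0 gcdp_eq0 negb_and monic_neq0.
by rewrite -val_eqE /=; case: (size _).
Qed.

Lemma card_sqfree_rV0 : #|sqfree_rV 0| = 1%N.
Proof.
rewrite (_ : sqfree_rV 0 = finset.setT) ?cardsT ?card_rV //.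
apply/setP => x; rewrite !inE monic_poly0 coef1 oner_eq0.
by rewrite unlock coprime1p.
Qed.

Lemma card_sqfree_rV_at0 c : #|sqfree_rV_at c 0| = 1%N.
Proof.
rewrite -[RHS]card_sqfree_rV0; apply: eq_card => x.
by rewrite inE monic_poly0 root1 andbT.
Qed.

(** A squarefree polynomial vanishing at c is (X - c) g with g squarefree and nonzero at c; as c <>
    0, the constant term of g stays nonzero. *)
Lemma card_sqfree_rV_at_rec c n : c != 0 ->
  #|sqfree_rV n.+1| = (#|sqfree_rV_at c n.+1| + #|sqfree_rV_at c n|)%N.
Proof.
move=> c0; rewrite -(@imset_adjoin_root c n _ (sqfree_rV n.+1)).
  rewrite addnC -!sum1_card [LHS](bigID (fun x => root (monic_poly x) c)) /=.
  by congr addn; apply: eq_bigl => x; rewrite [RHS]inE.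
move=> y; rewrite !inE adjoin_rootE separable_root coef0M mulf_eq0 negb_or -andbA.
by rewrite coefB coefX coefC sub0r oppr_eq0 c0 /= andbA.
Qed.

Lemma card_nonroot_rV n c :
  (#|[set u : 'rV[F]_n.+1 | ~~ root (rVpoly u) c]| + q ^ n = q ^ n.+1)%N.
Proof.
pose f (y : 'rV[F]_n) : 'rV[F]_n.+1 := poly_rV (rVpoly y * ('X - c%:P)).
have fE y : rVpoly (f y) = rVpoly y * ('X - c%:P).
  rewrite poly_rV_K // (leq_trans (size_polyMleq _ _)) // size_XsubC addn2 /=.
  by rewrite ltnS size_poly.
have finj : injective f.
  move=> y z /(congr1 rVpoly); rewrite !fE => /mulIf.
  by rewrite polyXsubC_eq0 => /(_ isT)/(can_inj rVpolyK).
rewrite -(card_rV n.+1) -(cardsC [set u : 'rV[F]_n.+1 | ~~ root (rVpoly u) c]).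
congr addn; rewrite -card_rV -cardsT -(card_imset _ finj); apply: eq_card => u.
rewrite !inE negbK; apply/imsetP/idP => [[y _ ->]|].
  by rewrite fE rootM root_XsubC eqxx orbT.
rewrite root_factor_theorem => /dvdpP[g gE].
exists (poly_rV g) => //; apply: (can_inj rVpolyK); rewrite fE poly_rV_K // -ltnS.
have [->|g0] := eqVneq g 0; first by rewrite size_poly0.
have : (size (rVpoly u) <= n.+1)%N by apply: size_poly.
by rewrite gE size_Mmonic ?monicXsubC // size_XsubC addn2.
Qed.

Lemma card_simple_pairs_at n c : c != 0 ->
  #|[set xu in simple_pairs n.+2 | sqrt_part (monic_poly xu.1) == 'X - c%:P]| =
  (#|sqfree_rV_at c n| * #|[set u : 'rV[F]_n.+2 | ~~ root (rVpoly u) c]|)%N.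
Proof.
move=> c0; rewrite -cardsX.
pose f (z : 'rV[F]_n * 'rV[F]_n.+2) :=
  (coef_rV n.+2 (('X - c%:P) ^+ 2 * monic_poly z.1), z.2).
have fE z : monic_poly (f z).1 = ('X - c%:P) ^+ 2 * monic_poly z.1.
  rewrite coef_rVK ?monicMl ?monic_exp ?monic_polyP ?monicXsubC //.
  by rewrite size_sqr_mul ?monic_polyP ?monicXsubC // size_monic_poly size_XsubC.
have finj : injective f.
  move=> [h u] [h' u'] E; have := congr1 (fun z => monic_poly z.1) E; rewrite !fE.
  move=> /mulfI; rewrite expf_eq0 polyXsubC_eq0 => /(_ isT)/monic_poly_inj /= ->.
  by case: E => _ ->.
rewrite -(card_imset _ finj); apply/eq_card => -[x u]; rewrite inE.
apply/andP/imsetP => [[]|[[h u'] /finset.setXP[hs u's] ->]]; last first.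
  move: hs u's; rewrite !inE fE /= => /andP[/andP[h0 sh] rh] ru.
  rewrite sqrt_partE ?sqfree_partE ?monicXsubC ?monic_polyP // size_XsubC eqxx.
  rewrite coprimep_sym coprimep_XsubC rootM negb_or rh ru coef0_sqr_mul h0.
  by rewrite coefB coefX coefC sub0r oppr_eq0 c0.
rewrite !inE /= => /and3P[x0 _ cop] /eqP rE.
have [mr mh sh xE] := sqrt_part_spec (monic_polyP x).
move: cop; rewrite rE coprimep_sym coprimep_XsubC rootM negb_or => /andP[rh ru].
move: x0; rewrite xE rE coef0_sqr_mul => /andP[_ h0].
have sz : size (sqfree_part (monic_poly x)) = n.+1.
  have := congr1 (size : {poly F} -> nat) xE.
  by rewrite size_monic_poly size_sqr_mul // rE size_XsubC => -[].
exists (coef_rV n (sqfree_part (monic_poly x)), u).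
  by apply/finset.setXP; rewrite !inE !coef_rVK // h0 sh rh.
by congr pair; apply: monic_poly_inj; rewrite (fE (_, u)) /= coef_rVK // -rE.
Qed.

(** Both counts satisfy the recurrence [card_sqfree_rV_at_rec], whose left side is free of c, and
    both start at 1. *)
Lemma card_sqfree_rV_at c c' n : c != 0 -> c' != 0 ->
  #|sqfree_rV_at c n| = #|sqfree_rV_at c' n|.
Proof.
move=> c0 c'0; elim: n => [|n IHn]; first by rewrite !card_sqfree_rV_at0.
by apply: (@addIn #|sqfree_rV_at c n|); rewrite {2}IHn -!card_sqfree_rV_at_rec.
Qed.

Lemma card_simple_pairs n : #|simple_pairs n.+2| =
  (q.-1 * (#|sqfree_rV_at 1 n| * (q ^ n.+2 - q ^ n.+1)))%N.
Proof.
pose c (xu : 'rV[F]_n.+2 * 'rV[F]_n.+2) := - (sqrt_part (monic_poly xu.1))`_0.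
rewrite (card_sum_fibers _ c) (bigID (fun a => a == 0)) /=.
(* The root 0 contributes nothing: r(0) = 0 would force f(0) = 0. This leaves q - 1 roots. *)
rewrite big1 => [|a /eqP ->]; last first.
  apply/eqP; rewrite cards_eq0; apply/eqP/setP => xu; rewrite !inE.
  apply/negP => /andP[/and3P[x0 _ _]]; rewrite oppr_eq0.
  have [_ _ _ xE] := sqrt_part_spec (monic_polyP xu.1).
  by move: x0; rewrite {1}xE coef0_sqr_mul /c => /andP[/negPf->].
rewrite add0n -(cardC1 (0 : F)) -sum_nat_const; apply: eq_bigr => a a0.
have -> : (q ^ n.+2 - q ^ n.+1 = #|[set u : 'rV[F]_n.+2 | ~~ root (rVpoly u) a]|)%N.
  by rewrite -(card_nonroot_rV n.+1 a) addnK.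
rewrite (card_sqfree_rV_at _ (oner_neq0 _) a0) -card_simple_pairs_at //.
apply: eq_card => xu; rewrite [LHS]inE [RHS]inE.
have [] := boolP (xu \in simple_pairs _) => //=; rewrite inE => /and3P[_ s2 _].
have [mr _ _ _] := sqrt_part_spec (monic_polyP xu.1); rewrite /c.
move: (sqrt_part _) mr s2 => r mr /eqP s2; apply/eqP/eqP => [rE|->].
  by rewrite (monic_size2 mr s2) rE.
by rewrite coefB coefX coefC sub0r opprK.
Qed.

End Counting.

(** * Solving the recurrences *)

Section Recurrences.
Variables (R : realFieldType) (q : R) (N : nat -> R).
Hypotheses (q_gt1 : 1 < q) (N0 : N 0%N = 1).
Hypothesis NS : forall n, N n.+1 = (q - 1) * q ^+ n.

Let q_neq0 : q != 0. Proof. by rewrite gt_eqF ?(lt_trans ltr01). Qed.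
Let q_gt0 : 0 < q. Proof. exact: lt_trans ltr01 q_gt1. Qed.
Let q1_neq0 : q + 1 != 0. Proof. by rewrite gt_eqF ?addr_gt0. Qed.
Let qB1_neq0 : q - 1 != 0. Proof. by rewrite gt_eqF ?subr_gt0. Qed.
Let q2_neq0 : q ^+ 2 + q + 1 != 0. 
Proof.
by rewrite lt0r_neq0 // !addr_gt0 ?exprn_gt0.
Qed.

Lemma ind_step2 (P : nat -> Prop) :
  P 0%N -> P 1%N -> (forall n, P n -> P n.+2) -> forall n, P n.
Proof.
move=> P0 P1 PS n; suff : P n /\ P n.+1 by case.
by elim: n => [|n [Pn PnS]]; split=> //; exact: PS.
Qed.

Section SquareFree.
Variable S : nat -> R.
Hypothesis rec : forall n, N n = \sum_(k < n./2.+1) N k * S (n - k.*2)%N.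

(** [N k] is geometric only for k > 0. With the pure weights q^k, [T] shifts well, and eliminating
    [S n.+2] between [TSS] and [NSS] leaves T (n + 2) = N (n + 2) + T n, where the right side is
    known. *)
Let T n := \sum_(k < n./2.+1) q ^+ k * S (n - k.*2)%N.

Let TSS n : T n.+2 = S n.+2 + q * T n.
Proof.
rewrite /T /= big_ord_recl /= subn0 expr0 mul1r; congr (_ + _).
by rewrite mulr_sumr; apply: eq_bigr => k _; rewrite exprS mulrA.
Qed.

Let NSS n : N n.+2 = S n.+2 + (q - 1) * T n.
Proof.
rewrite rec /= big_ord_recl /= subn0 N0 mul1r; congr (_ + _).
by rewrite mulr_sumr; apply: eq_bigr => k _; rewrite NS mulrA.
Qed.

Let S0 : S 0%N = 1.
Proof. by have := rec 0; rewrite big_ord1 N0 mul1r. Qed.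

Let S1 : S 1%N = q - 1.
Proof. by have := rec 1; rewrite big_ord1 N0 mul1r NS mulr1. Qed.

Let TE n : T n = (q ^+ n.+1 + (-1) ^+ n) / (q + 1).
Proof.
elim/ind_step2: n => [||n IHn].
- by rewrite /T big_ord1 S0; field.
- by rewrite /T big_ord1 S1; field.
have -> : T n.+2 = N n.+2 + T n by rewrite TSS NSS; ring.
by rewrite IHn NS !exprS; field.
Qed.

(** The index starts at 1 because the same formula would give 0 instead of 1 at index 0. *)
Lemma sqfree_recE n : S n.+1 = (q - 1) * (q ^+ n.+1 + (-1) ^+ n) / (q + 1).
Proof.
case: n => [|n]; first by rewrite S1; field.
have -> : S n.+2 = T n.+2 - q * T n by rewrite TSS; ring.
by rewrite !TE !exprS; field.
Qed.

Variable Q : nat -> R.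
Hypotheses (Q0 : Q 0%N = 1) (Qrec : forall n, S n.+1 = Q n.+1 + Q n).

(** The term (-1)^n of S is itself a solution of Q (n + 1) + Q n = 0; this resonance creates the
    factor n + 1. *)
Lemma sqfree_at_recE n : Q n = (q - 1) * q ^+ n.+1 / (q + 1) ^+ 2 -
  (-1) ^+ n * (n.+1%:R * (q - 1) / (q + 1) - q * (q + 3) / (q + 1) ^+ 2).
Proof.
elim: n => [|n IHn]; first by rewrite Q0; field.
have -> : Q n.+1 = S n.+1 - Q n by rewrite Qrec; ring.
by rewrite IHn sqfree_recE -!natr1 !exprS; field.
Qed.

End SquareFree.

Section Coprime.
Variable W : nat -> R.
Hypothesis rec : forall n,
  q ^+ n * N n = \sum_(k < n./2.+1) N k * q ^+ k * W (n - k.*2)%N.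

(** Dividing by q^n turns the weights of the recurrence into N k / q^k, which is the constant (q -
    1) / q for k > 0; [T] then has all weights equal to 1. *)
Let V n := W n / q ^+ n.
Let T n := \sum_(k < n./2.+1) V (n - k.*2)%N.

Let TSS n : T n.+2 = V n.+2 + T n.
Proof. by rewrite /T /= big_ord_recl /= subn0. Qed.

Let recV n : N n = \sum_(k < n./2.+1) N k / q ^+ k * V (n - k.*2)%N.
Proof.
apply: (mulfI (expf_neq0 n q_neq0)); rewrite rec mulr_sumr; apply: eq_bigr => k _.
have -> : q ^+ n = q ^+ k * q ^+ k * q ^+ (n - k.*2)%N.
  by rewrite -!exprD; congr (_ ^+ _); have := ltn_ord k; lia.
by rewrite /V; field; rewrite !expf_neq0.
Qed.

Let NSS n : N n.+2 = V n.+2 + (q - 1) / q * T n.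
Proof.
rewrite recV /= big_ord_recl /= subn0 N0 expr0 divr1 mul1r; congr (_ + _).
rewrite mulr_sumr; apply: eq_bigr => k _; rewrite NS exprS /bump /= add1n.
by congr (_ * _); field; rewrite q_neq0 expf_neq0.
Qed.

Let V0 : V 0%N = 1.
Proof. by have := recV 0; rewrite big_ord1 N0 expr0 divr1 mul1r. Qed.

Let V1 : V 1%N = q - 1.
Proof. by have := recV 1; rewrite big_ord1 N0 expr0 divr1 mul1r NS mulr1. Qed.

Let s := q ^+ 2 + q + 1.

(** Eliminating [V n.+2] gives T (n + 2) = N (n + 2) + T n / q. The homogeneous part is c / q^(n/2)
    with one constant per parity, fixed by T 0 = 1 and T 1 = q - 1. *)
Let TE n : T n = q ^+ n.+2 / s +
  (if odd n then - 1 else q + 1) / (s * q ^+ n./2).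
Proof.
elim/ind_step2: n => [||n IHn].
- by rewrite /T big_ord1 V0 /s /=; field.
- by rewrite /T big_ord1 V1 /s /=; field.
have -> : T n.+2 = N n.+2 + T n / q by rewrite TSS NSS; field.
rewrite IHn NS /= negbK !exprS; move: (if odd n then _ else _) => c; rewrite /s.
by field; rewrite q_neq0 q2_neq0 expf_neq0.
Qed.

Lemma coprime_recE n : W n.+2 / (q ^+ n.+2 * N n.+2) = 1 - 1 / s +
  (if odd n then 1 else - (q + 1)) / (s * q ^+ (n./2 + n.+2)).
Proof.
have -> : W n.+2 / (q ^+ n.+2 * N n.+2) = (T n.+2 - T n) / N n.+2.
  by rewrite TSS addrK /V NS; field; rewrite qB1_neq0 ?q_neq0 !expf_neq0.
have -> : (if odd n then 1 else - (q + 1)) = - (if odd n then - 1 else q + 1).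
  by case: odd; rewrite ?opprK.
rewrite !TE NS /= negbK exprD /s.
(* The identity holds for any value of the parity constant, so one computation covers both cases. *)
move: (if odd n then _ else _) => c; rewrite !exprS.
by field; rewrite q_neq0 q2_neq0 qB1_neq0 !expf_neq0.
Qed.

End Coprime.
End Recurrences.

(** * Proportions of pairs over a finite field *)

Section Proportions.
Variables (R : realFieldType) (F : finFieldType).
Local Notation q := (#|F|%:R : R).
Local Notation N n := (#|const_neq0 F n|%:R : R).
Local Notation total n := ((#|F| ^ n * #|const_neq0 F n|)%N%:R : R).

Let q_gt1 : 1 < q. Proof. by rewrite ltr1n finNzRing_gt1. Qed.
Let q_gt0 : 0 < q. Proof. exact: lt_trans ltr01 q_gt1. Qed.
Let q_neq0 : q != 0. Proof. by rewrite gt_eqF. Qed.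
Let q1_neq0 : q + 1 != 0. Proof. by rewrite gt_eqF ?addr_gt0. Qed.
Let qB1_neq0 : q - 1 != 0. Proof. by rewrite gt_eqF ?subr_gt0. Qed.
Let q2_neq0 : q ^+ 2 + q + 1 != 0.
Proof. by rewrite gt_eqF // !addr_gt0 ?exprn_gt0. Qed.

Let N0 : N 0 = 1. Proof. by rewrite card_const_neq00. Qed.

Let NS n : N n.+1 = (q - 1) * q ^+ n.
Proof.
have := congr1 (fun k => k%:R : R) (card_const_neq0S F n).
by rewrite natrD !natrX exprS mulrBl mul1r => <-; rewrite addrK.
Qed.

Lemma coprime_pairs_proportion n : (2 <= n)%N ->
  (#|coprime_pairs F n|%:R / total n : R) = 1 - 1 / (q ^+ 2 + q + 1) +
    (if odd n then 1 / ((q ^+ 2 + q + 1) * q ^+ (3 * (n - 1))./2)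
     else - ((q + 1) / ((q ^+ 2 + q + 1) * q ^+ ((3 * n)./2 - 1)))).
Proof.
case: n => [|[|n]] // _; rewrite natrM natrX.
rewrite [LHS](@coprime_recE _ _ (fun n => N n) q_gt1 N0 NS
  (fun n => #|coprime_pairs F n|%:R)) => [|m].
  (* The index has been lowered by 2: m/2 + m + 2 (with m/2 rounded down) is 3(m + 1)/2 for odd m
     and 3(m + 2)/2 - 1 for even m. *)
  congr (_ + _); rewrite /= negbK; case: ifP => on; rewrite ?mulNr.
    by congr (_ / (_ * _ ^+ _)); move: on; lia.
  by congr (- (_ / (_ * _ ^+ _))); move: on; lia.
have := congr1 (fun k => k%:R : R) (card_coprime_pairs_rec F m).
by rewrite natrM natrX natr_sum => ->; apply: eq_bigr => k _; rewrite !natrM natrX.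
Qed.

Let sqfree_rec n : N n = \sum_(k < n./2.+1) N k * #|sqfree_rV F (n - k.*2)|%:R.
Proof.
by rewrite card_const_neq0_rec natr_sum; apply: eq_bigr => k _; rewrite natrM.
Qed.

Lemma sqfree_proportion n : (0 < n)%N ->
  ((#|F| ^ n * #|sqfree_rV F n|)%N%:R / total n : R) =
  q / (q + 1) * (1 - (-1) ^+ n / q ^+ n).
Proof.
case: n => [|n] // _; rewrite !natrM natrX NS.
rewrite (sqfree_recE (N := fun n => N n)
  (S := fun n => #|sqfree_rV F n|%:R) q_gt1 N0 NS sqfree_rec) !exprS.
by field; rewrite q_neq0 q1_neq0 qB1_neq0 !expf_neq0.
Qed.

Lemma simple_pairs_proportion n : (2 <= n)%N ->
  (#|simple_pairs F n|%:R / total n : R) =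
  (q - 1) ^+ 2 / (q * (q + 1) ^+ 2) - (-1) ^+ n / q ^+ n *
    ((n%:R - 1) * ((q - 1) ^+ 2 / (q + 1)) -
     q * (q - 1) * (q + 3) / (q + 1) ^+ 2).
Proof.
case: n => [|[|n]] // _; rewrite [X in _ / X]natrM natrX NS card_simple_pairs 2!natrM.
rewrite natrB ?leq_exp2l ?finNzRing_gt1 // -subn1 natrB ?(ltnW (finNzRing_gt1 _)) //.
rewrite (sqfree_at_recE (N := fun n => N n)
  (S := fun n => #|sqfree_rV F n|%:R) q_gt1 N0 NS sqfree_rec
  (Q := fun n => #|sqfree_rV_at (1 : F) n|%:R)) => [||m].
- rewrite !natrX -!natr1 !exprS.
  by field; rewrite q_neq0 q1_neq0 qB1_neq0 !expf_neq0.
- by rewrite card_sqfree_rV_at0.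
- by rewrite (card_sqfree_rV_at_rec _ (oner_neq0 F)) natrD.
Qed.

End Proportions.

(** * The residue field of Z_p *)

Section Residue.
Variables (p : nat) (pr_p : prime p).
Local Notation Zp := (padic_int pr_p).
Implicit Types x y : Zp.

Lemma eq_residue k (a b : nat) :
  ((a%:R : 'Z_(p ^ k.+1)) = b%:R) <-> (a = b %[mod p ^ k.+1])%N.
Proof.
split=> [/(congr1 val)|ab]; last apply: val_inj;
  by rewrite /= !val_Zp_nat ?gt1_pX.
Qed.

Lemma residue_natr (n : nat) k : residue (n%:R : Zp) k = n%:R.
Proof. by elim: n => [|n IHn] //; rewrite -natr1 /= IHn natr1. Qed.

Lemma residue0_modn x k : (residue x k = residue x 0 %[mod p])%N.
Proof. exact: (residue_modn x k 0). Qed.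

(** The detour through [nat] is due to 'Z_(p ^ 1) and 'F_p being distinct types; only the latter is
    a field for the library. *)
Definition red x : 'F_p := (residue x 0 : nat)%:R.

Fact red_is_zmod_morphism : zmod_morphism red.
Proof.
move=> x y; apply/esym/eqP; rewrite subr_eq; apply/eqP.
rewrite /red -natrD -(Fp_nat_mod pr_p) -[RHS](Fp_nat_mod pr_p); congr (_%:R).
have -> : x = (x - y) + y by rewrite subrK.
move: (x - y) => z; rewrite addrK [residue (z + y) 0]/=.
by rewrite (residueD pr_p); exact: modn_mod.
Qed.

Fact red_is_monoid_morphism : monoid_morphism red.
Proof.
split=> [|x y]; first by rewrite /red.
rewrite /red -natrM -(Fp_nat_mod pr_p) -[RHS](Fp_nat_mod pr_p); congr (_%:R).
by rewrite [residue (x * y) 0]/= (residueM pr_p); exact: modn_mod.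
Qed.

HB.instance Definition _ := GRing.isZmodMorphism.Build Zp 'F_p red red_is_zmod_morphism.
HB.instance Definition _ := GRing.isMonoidMorphism.Build Zp 'F_p red red_is_monoid_morphism.

Lemma red_eq0 x : red x = 0 -> exists y, x = p%:R * y.
Proof.
move=> /(congr1 val); rewrite /= val_Fp_nat // => x0.
have px k : (p %| residue x k)%N by rewrite /dvdn residue0_modn x0.
(* Division by p costs one digit, so level k of the quotient is read from level k + 1 of x. *)
pose s k : 'Z_(p ^ k.+1) := (residue x k.+1 %/ p)%N%:R.
have sP k : (s k.+1 : nat)%:R = s k.
  apply/eq_residue; rewrite val_Zp_nat ?gt1_pX // modn_dvdm ?dvdn_exp2l //.
  apply/eqP; rewrite -(eqn_pmul2l (prime_gt0 pr_p)) !muln_modr -expnS.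
  rewrite ![(p * (_ %/ _))%N]mulnC !divnK //.
  by have := residue_modn x 1 k.+1; rewrite addn1 => ->.
exists (PadicInt pr_p sP); apply: padicP => k.
have -> : residue (p%:R * PadicInt pr_p sP) k = residue (p%:R : Zp) k * s k by [].
rewrite residue_natr /s -natrM mulnC divnK //.
by rewrite -residueP.
Qed.

Lemma red_p : red p%:R = 0.
Proof. by rewrite rmorph_nat pchar_Fp_0. Qed.

Lemma padic_p_neq0 : p%:R != 0 :> Zp.
Proof.
apply/eqP => /(congr1 (fun x : Zp => residue x 1)); rewrite residue_natr.
move/(congr1 val); rewrite /= val_Zp_nat ?gt1_pX // modn_small => [|].
  by apply/eqP; rewrite -lt0n prime_gt0.
by rewrite -[X in (X < _)%N]expn1 ltn_exp2l ?prime_gt1.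
Qed.

Lemma padic_dvdP x : padic_dvd p%:R x <-> red x = 0.
Proof.
split=> [[c ->]|/red_eq0[y ->]]; last by exists y; rewrite mulrC.
by rewrite rmorphM /= red_p mulr0.
Qed.

(** Every residue is prime to p, hence invertible, and uniqueness of inverses makes the levels
    compatible. *)
Lemma red_unit x : red x != 0 -> x \is a GRing.unit.
Proof.
move=> x0; have ux k : residue x k \is a GRing.unit.
  rewrite -[residue x k]natr_Zp unitZpE ?gt1_pX // coprimeXl //.
  rewrite prime_coprime //; apply: contra x0 => px; apply/eqP.
  by rewrite /red -(Fp_nat_mod pr_p) -(residue0_modn x k) (eqP px).
have sP k : reduct (residue x k.+1)^-1 = (residue x k)^-1.
  have xE : reduct (residue x k.+1) = residue x k by exact: residueP.
  by apply: (mulIr (ux k)); rewrite mulVr ?ux // -{1}xE -(reductM pr_p) mulVr ?ux ?reduct1.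
have yx : PadicInt pr_p sP * x = 1.
  by apply: padicP => k; apply: (mulVr (ux k)).
by apply/unitrP; exists (PadicInt pr_p sP); split; rewrite // mulrC.
Qed.

(** A level k at which x is nonzero bounds its valuation, and each division by p lowers this level
    by one. *)
Lemma padic_factor x : x != 0 ->
  exists k u, red u != 0 /\ x = p%:R ^+ k * u.
Proof.
move=> /residue_neq0[k]; elim: k x => [|k IHk] x xk.
  exists 0%N, x; rewrite expr0 mul1r; split=> //; apply: contra xk => /eqP.
  move/(congr1 val); rewrite /= val_Fp_nat // => x0.
  exact/eqP.
have [/red_eq0[y xE]|x0] := eqVneq (red x) 0; last first.
  by exists 0%N, x; rewrite expr0 mul1r.
have [|j [u [u0 yE]]] := IHk y; last first.
  by exists j.+1, u; rewrite xE yE exprS mulrA.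
apply: contra xk => yk.
rewrite xE [residue _ _]/= (residueM pr_p) residue_natr val_Zp_nat ?gt1_pX //.
rewrite /dvdn modnMml modn_mod -/(dvdn _ _).
have : (p ^ k.+1 %| residue y k.+1)%N.
  by have := residue_modn y 1 k; rewrite addn1 /dvdn => ->.
by move: (nat_of_ord _) => m pm; rewrite expnS dvdn_mul.
Qed.

End Residue.

(** * Sylvester matrices *)

Section RowReplacement.
Variables (S : comNzRingType) (N : nat) (i0 : 'I_N).

Definition replace_row (A : 'M[S]_N) (w : 'rV[S]_N) : 'M[S]_N :=
  \matrix_(i, j) if i == i0 then w 0 j else A i j.

Lemma mul_replace_row (A : 'M[S]_N) (w v : 'rV[S]_N) :
  v *m replace_row A w =
  (\row_j if j == i0 then 0 else v 0 j) *m A + v 0 i0 *: w.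
Proof.
apply/rowP => j; rewrite !mxE (bigD1 i0) //= [X in _ = X + _](bigD1 i0) //=.
rewrite !mxE eqxx mul0r add0r addrC; congr (_ + _).
by apply: eq_bigr => i /negPf ii0; rewrite !mxE ii0.
Qed.

Lemma det_replace_last_row (A : 'M[S]_N) (c w : 'rV[S]_N) (a : S) :
    (forall i : 'I_N, i <= i0)%N -> c 0 i0 = 1 -> c *m A = a *: w ->
  \det A = a * \det (replace_row A w).
Proof.
(* The identity with last row c is lower triangular with unit diagonal, so it has determinant 1. No
   division by a occurs, which allows a = p. *)
move=> i0max c1 cA; pose T := replace_row 1%:M c.
have TA : T *m A = replace_row A (a *: w).
  apply/row_matrixP => i; rewrite row_mul.
  have [->|ii0] := eqVneq i i0.
    have -> : row i0 T = c by apply/rowP => j; rewrite !mxE eqxx.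
    by rewrite cA; apply/rowP => j; rewrite !mxE eqxx.
  have -> : row i T = row i 1%:M by apply/rowP => j; rewrite !mxE (negPf ii0).
  by rewrite -row_mul mul1mx; apply/rowP => j; rewrite !mxE (negPf ii0).
have detT : \det T = 1.
  rewrite det_trig.
    rewrite big1 // => i _; rewrite mxE.
    by case: eqVneq => [->|_]; rewrite // mxE eqxx.
  apply/is_trig_mxP => i j ij; rewrite !mxE; case: eqP => [ii0|_].
    by move: ij; rewrite ii0 ltnNge i0max.
  by case: eqP => // ij'; rewrite ij' ltnn in ij.
have lift_i0 i : (lift i0 i == i0) = false.
  by rewrite eq_sym (negPf (neq_lift _ _)).
rewrite -[LHS]mul1r -detT -det_mulmx TA.
rewrite (@determinant_multilinear _ _ _ (replace_row A w) (replace_row A w) i0 a 0).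
- by rewrite mul0r addr0.
- by rewrite scale0r addr0; apply/rowP => j; rewrite !mxE eqxx.
- by apply/matrixP => i j; rewrite !mxE lift_i0.
- by apply/matrixP => i j; rewrite !mxE lift_i0.
Qed.

End RowReplacement.

Section Sylvester.

Lemma row_mx_eq0 (S : nmodType) m n1 n2 (a : 'M[S]_(m, n1)) (b : 'M[S]_(m, n2)) :
  (row_mx a b == 0) = (a == 0) && (b == 0).
Proof.
apply/eqP/andP => [|[/eqP-> /eqP->]]; last exact: row_mx0.
by rewrite -row_mx0 => /eq_row_mx[-> ->].
Qed.

(** The size is prescribed rather than read off the degrees, so that the matrix commutes with
    reduction modulo p even when f' loses degree. *)
Definition sylvester (S : nzRingType) m n (f g : {poly S}) : 'M[S]_(m + n) :=
  col_mx (lin1_mx (poly_rV \o f \o* rVpoly)) (lin1_mx (poly_rV \o g \o* rVpoly)).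

Lemma resultantE (S : nzRingType) m n (f g : {poly S}) :
  size f = n.+1 -> size g = m.+1 -> resultant f g = \det (sylvester m n f g).
Proof. by rewrite /resultant /Sylvester_mx => -> ->. Qed.

Lemma mul_sylvester (S : nzRingType) m n (f g : {poly S}) (v : 'rV[S]_(m + n)) :
  v *m sylvester m n f g =
  poly_rV (rVpoly (lsubmx v) * f + rVpoly (rsubmx v) * g).
Proof. by rewrite -{1}[v]hsubmxK mul_row_col !mul_rV_lin1 /= linearD. Qed.

Lemma map_sylvester (S T : nzRingType) (h : {rmorphism S -> T}) m n
    (f g : {poly S}) :
  map_mx h (sylvester m n f g) = sylvester m n (map_poly h f) (map_poly h g).
Proof.
by rewrite map_col_mx; congr col_mx; apply: map_lin1_mx => v /=;
  rewrite map_poly_rV rmorphM /= map_rVpoly.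
Qed.

Variables (F : fieldType) (m n : nat) (f g : {poly F}).
Hypotheses (sf : (size f <= n.+1)%N) (sg : (size g <= m.+1)%N).

Let size_comb (a b : {poly F}) : (size a <= m)%N -> (size b <= n)%N ->
  (size (a * f + b * g)%R <= m + n)%N.
Proof.
move=> sa sb; rewrite (leq_trans (size_polyD _ _)) // geq_max.
rewrite !(leq_trans (size_polyMleq _ _)) //.
  by move: (size b) (size g) sb sg; lia.
by move: (size a) (size f) sa sf; lia.
Qed.

(** A vector of the left kernel is a pair (a, b), and a f + b g is small enough to be recovered from
    its coefficient vector. *)
Lemma det_sylvester_eq0 : \det (sylvester m n f g) = 0 <->
  exists a b : {poly F}, [/\ (size a <= m)%N, (size b <= n)%N, (a != 0) || (b != 0)
               & a * f + b * g = 0].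
Proof.
split=> [/eqP/det0P[v v0]|[a [b [sa sb ab0 E]]]].
  rewrite mul_sylvester => E; exists (rVpoly (lsubmx v)), (rVpoly (rsubmx v)).
  split; [exact: size_poly | exact: size_poly | |].
    move: v0; rewrite -{1}[v]hsubmxK row_mx_eq0 negb_and.
    by rewrite -!(can_eq rVpolyK) !linear0.
  rewrite -[LHS](@poly_rV_K _ (m + n)) ?E ?linear0 //.
  by apply: size_comb; apply: size_poly.
apply/eqP/det0P; exists (row_mx (poly_rV a) (poly_rV b)).
  by rewrite row_mx_eq0 negb_and -!(can_eq rVpolyK) !linear0 !poly_rV_K.
by rewrite mul_sylvester row_mxKl row_mxKr !poly_rV_K // E linear0.
Qed.

End Sylvester.

Section SylvesterReplaced.
Variables (F : fieldType) (m n : nat) (f g w : {poly F}).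
Hypotheses (sf : (size f <= n.+2)%N) (sg : (size g <= m.+1)%N).
Hypothesis sw : (size w <= m + n.+1)%N.

(** This is the row of 'X^n g. Replacing it by w trades the top coefficient of b for the coefficient
    t of w, whence the sharper bound on the size of b below. *)
Definition last_row : 'I_(m + n.+1) := rshift m ord_max.

Lemma last_row_max (i : 'I_(m + n.+1)) : (i <= last_row)%N.
Proof. by rewrite /= -ltnS -addnS ltn_ord. Qed.

Lemma det_replace_sylvester_eq0 :
  \det (replace_row last_row (sylvester m n.+1 f g) (poly_rV w)) = 0 <->
  exists (a b : {poly F}) t, [/\ (size a <= m)%N, (size b <= n)%N,
    [|| a != 0, b != 0 | t != 0] & a * f + b * g + t *: w = 0].
Proof.
split=> [/eqP/det0P[v v0]|[a [b [t [sa sb nz E]]]]].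
  rewrite mul_replace_row mul_sylvester -linearZ -linearD /=.
  set v' := \row_j _; pose a := rVpoly (lsubmx v'); pose b := rVpoly (rsubmx v').
  have sb : (size b <= n)%N.
    apply/leq_sizeP => j; rewrite leq_eqVlt => /predU1P[<-|nj]; last first.
      by rewrite nth_default // (leq_trans (size_poly _ _)).
    have := coef_rVpoly_ord (rsubmx v') ord_max.
    by rewrite mxE [v' _ _]mxE eqxx.
  rewrite -/a -/b => E; exists a, b, (v 0 last_row); split=> //; first exact: size_poly.
    apply: contraNT v0; rewrite !negb_or !negbK => /and3P[/eqP a0 /eqP b0 /eqP t0].
    apply/eqP/rowP => j; rewrite mxE.
    have v'0 : v' = 0.
      rewrite -[v']hsubmxK (can_inj rVpolyK (_ : rVpoly (lsubmx v') = rVpoly 0)).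
        rewrite (can_inj rVpolyK (_ : rVpoly (rsubmx v') = rVpoly 0)) ?row_mx0 //.
        by rewrite linear0.
      by rewrite linear0.
    have := congr1 (fun z : 'rV_(m + n.+1) => z 0 j) v'0; rewrite !mxE.
    by case: eqP => [->|].
  rewrite -[LHS](@poly_rV_K _ (m + n.+1)) ?E ?linear0 //.
  rewrite (leq_trans (size_polyD _ _)) // geq_max.
  rewrite (leq_trans (size_scale_leq _ _) sw) andbT.
  rewrite (leq_trans (size_polyD _ _)) // geq_max.
  rewrite !(leq_trans (size_polyMleq _ _)) //.
    by have : (size b <= n)%N := sb; move: (size b) (size g) sg; lia.
  have : (size a <= m)%N by apply: size_poly.
  by move: (size a) (size f) sf; lia.
apply/eqP/det0P; pose v0 : 'rV_(m + n.+1) := row_mx (poly_rV a) (poly_rV b).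
have v00 : v0 0 last_row = 0.
  by rewrite row_mxEr mxE nth_default.
pose v := \row_j if j == last_row then t else v0 0 j; exists v.
  apply: contraTneq nz => ve0.
  have t0 : t = 0.
    by have := congr1 (fun z : 'rV_(m + n.+1) => z 0 last_row) ve0; rewrite !mxE eqxx.
  have : v0 = 0.
    apply/rowP => j; have := congr1 (fun z : 'rV_(m + n.+1) => z 0 j) ve0.
    by rewrite !mxE; case: eqP => [-> _|//]; rewrite -v00 mxE.
  move/eqP; rewrite row_mx_eq0 -!(can_eq rVpolyK) !linear0 !poly_rV_K ?(leqW sb) //.
  by rewrite t0 eqxx orbF -negb_and negbK.
rewrite mul_replace_row (_ : \row_j _ = v0) => [|].
  rewrite mul_sylvester row_mxKl row_mxKr !poly_rV_K ?(leqW sb) // -linearZ -linearD.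
  by rewrite mxE eqxx E linear0.
by apply/rowP => j; rewrite !mxE; case: eqP => // ->; rewrite -[LHS]v00 mxE.
Qed.

End SylvesterReplaced.

(** * Sylvester determinants of r^2 h over a field *)

Section SquareFactorSizes.
Variables (S : idomainType) (n j : nat) (r h : {poly S}).
Hypotheses (mr : r \is monic) (mh : h \is monic).
Hypotheses (sf : size (r ^+ 2 * h) = n.+2) (sr : size r = j.+2).

Lemma size_sqrt_mul : size (r * h) = (n - j).+1.
Proof.
have h0 : (0 < size h)%N by rewrite size_poly_gt0 monic_neq0.
rewrite size_Mmonic ?monic_neq0 // sr.
by move: sf; rewrite size_sqr_mul // sr; move: (size h) h0; lia.
Qed.

Lemma leq_size_sqrt : (j <= n)%N.
Proof.
have h0 : (0 < size h)%N by rewrite size_poly_gt0 monic_neq0.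
by move: sf; rewrite size_sqr_mul // sr; move: (size h) h0; lia.
Qed.

(** The polynomial is the derivative of r^2 h divided by r. *)
Lemma size_deriv_sqrt : (size (r^`() * h *+ 2 + r * h^`())%R <= n - j)%N.
Proof.
have := size_sqrt_mul; rewrite size_Mmonic ?monic_neq0 // sr /= => -[sh].
have sr' : (size r^`() < size r)%N by rewrite lt_size_deriv ?monic_neq0.
have sh' : (size h^`() < size h)%N by rewrite lt_size_deriv ?monic_neq0.
rewrite (leq_trans (size_polyD _ _)) // geq_max mulr2n.
rewrite (leq_trans (size_polyD _ _)) ?geq_max ?andbb (leq_trans (size_polyMleq _ _)) //;
  by move: (size r^`()) (size h^`()) (size h) sr' sh' sh; rewrite sr; lia.
Qed.

End SquareFactorSizes.

Section SquareFactor.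
Variables (F : fieldType) (n : nat) (r h u : {poly F}).
Hypotheses (mr : r \is monic) (mh : h \is monic) (sep : separable_poly h).
Hypotheses (sf : size (r ^+ 2 * h) = n.+2) (su : (size u <= n.+1)%N).
Let f := r ^+ 2 * h.

Let f' : f^`() = r * (r^`() * h *+ 2 + r * h^`()).
Proof. by rewrite /f derivM expr2 derivM; ring. Qed.

Let sf' : (size f^`() <= n.+1)%N.
Proof. by rewrite -ltnS -sf lt_size_deriv // -size_poly_gt0 sf. Qed.

(** In a relation a f + b f' = 0, f divides b because it is prime to f'; but b has smaller degree
    than f, so b = 0 and then a = 0. *)
Lemma det_sylvester_separable : r = 1 -> \det (sylvester n n.+1 f f^`()) != 0.
Proof.
move=> r1; apply/eqP => /(det_sylvester_eq0 _ _)[||a [b [sa sb nz E]]].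
- by rewrite /f sf.
- by [].
have fh : f = h by rewrite /f r1 expr1n mul1r.
have f0 : f != 0 by rewrite -size_poly_gt0 sf.
have fb : f %| b.
  have : f %| b * f^`().
    by rewrite -(dvdp_addr _ (dvdp_mull a (dvdpp f))) E dvdp0.
  by rewrite Gauss_dvdpl // fh; move: sep; rewrite unlock.
have b0 : b = 0.
  apply/eqP; apply: contraTT fb => b0; apply/negP => /(dvdp_leq b0).
  by rewrite sf ltnNge sb.
move: E nz; rewrite b0 mul0r addr0 eqxx orbF => /eqP.
by rewrite mulf_eq0 (negPf f0) orbF => ->.
Qed.

Variable j : nat.
Hypothesis sr : size r = j.+2.
Let k := r^`() * h *+ 2 + r * h^`().
(** For f + p u over Z_p, combining the derivative times 'X^j r h with the polynomial times - 'X^j k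
    cancels r^2 h and leaves p w. The power 'X^j raises r h to degree n, that of the last row. *)
Let w := 'X^j * (r * h * u^`() - k * u).

Let size_rh : size (r * h) = (n - j).+1 := size_sqrt_mul mr mh sf sr.
Let leq_jn : (j <= n)%N := leq_size_sqrt mr mh sf sr.
Let size_k : (size k <= n - j)%N := size_deriv_sqrt mr mh sf sr.

Let size_w : (size w <= n + n.+1)%N.
Proof.
have su' : (size u^`() <= n)%N.
  have [->|u0] := eqVneq u 0; first by rewrite deriv0 size_poly0.
  by rewrite -ltnS (leq_trans _ su) // lt_size_deriv.
rewrite (leq_trans (size_polyMleq _ _)) // size_polyXn /=.
suff : (size (r * h * u^`() - k * u)%R <= n + n - j)%N.
  by move: leq_jn (size _); lia.
rewrite (leq_trans (size_polyD _ _)) // geq_max size_polyN.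
rewrite !(leq_trans (size_polyMleq _ _)) ?size_rh //.
  by move: leq_jn (size k) (size u) size_k su; lia.
by move: leq_jn (size u^`()) su'; lia.
Qed.

Let M := replace_row (last_row n n) (sylvester n n.+1 f f^`()) (poly_rV w).

(** Each row of M lists the coefficients of a polynomial vanishing at c, so the column of the powers
    of c is in the kernel. *)
Let det_common_root c : root f c -> root f^`() c -> root w c -> \det M = 0.
Proof.
move=> fc f'c wc; pose e : 'cV[F]_(n + n.+1) := \col_i c ^+ i.
have eval (g : {poly F}) : (size g <= n + n.+1)%N -> root g c -> poly_rV g *m e = 0.
  move=> sg /eqP gc; apply/rowP => i; rewrite !mxE -[RHS]gc (horner_coef_wide _ sg).
  by apply: eq_bigr => l _; rewrite !mxE.
have Me : M *m e = 0.
  apply/row_matrixP => i; rewrite row_mul rowE row0 mul_replace_row mul_sylvester.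
  rewrite -linearZ -linearD; apply: eval; last first.
    rewrite rootE hornerD hornerZ hornerD [(_ * f).[c]]hornerM
      [(_ * f^`()).[c]]hornerM (eqP fc) (eqP f'c) (eqP wc).
    by rewrite !mulr0 !addr0.
  set a := lsubmx _; set b := rsubmx _.
  rewrite (leq_trans (size_polyD _ _)) // geq_max (leq_trans (size_scale_leq _ _)) //.
  rewrite andbT (leq_trans (size_polyD _ _)) // geq_max.
  have sa : (size (rVpoly a) <= n)%N by apply: size_poly.
  have sb : (size (rVpoly b) <= n.+1)%N by apply: size_poly.
  rewrite !(leq_trans (size_polyMleq _ _)) //.
    by move: (size (rVpoly b)) (size f^`()) sb sf'; lia.
  by rewrite /f sf; move: (size (rVpoly a)) sa; lia.
apply/eqP; rewrite -det_tr; apply/det0P; exists e^T; last by rewrite -trmx_mul Me trmx0.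
apply/eqP => e0; have i0 : (0 < n + n.+1)%N by rewrite addnS.
have /eqP := congr1 (fun z : 'rV_(n + n.+1) => z 0 (Ordinal i0)) e0.
by rewrite !mxE expr0 oner_eq0.
Qed.

Lemma det_replace_sylvester_square_eq0 :
  \det M = 0 <-> ~~ ((j == 0%N) && coprimep r (2%:R * h * u)).
Proof.
have mf : f \is monic by rewrite monicMl ?monic_exp.
have f0 := monic_neq0 mf.
have [j0|j_gt0] := posnP j; last first.
  split=> // _; apply/det_replace_sylvester_eq0; rewrite ?sf //.
  (* Since f = r (r h) and f' = r k, these cofactors cancel; for j > 0 the size n - j + 1 of r h
     fits the bound n. *)
  exists (- k), (r * h), 0; rewrite size_polyN size_rh scale0r addr0.
  split; [by rewrite (leq_trans size_k) ?leq_subr | by move: leq_jn; lia | |].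
    by apply/or3P/Or32; rewrite mulf_neq0 ?monic_neq0.
  by rewrite f' -/k /f; ring.
have rE := monic_size2 mr; rewrite sr j0 in rE; have {}rE := rE erefl.
move: (- r`_0) rE => c rE.
have r1 : r^`() = 1 by rewrite rE derivB derivX derivC subr0.
split=> [/(det_replace_sylvester_eq0 _ _ _)[||//|a [b [t [sa sb nz E]]]]|].
- by rewrite /f sf.
- by [].
- apply/negP => /= cop; move: E nz; rewrite /w j0 expr0 mul1r => E.
  (* Reduce the relation modulo r: f and f' vanish, and w becomes - k u with k congruent to 2 h
     because r' = 1. *)
  have rw : r %| t *: (2%:R * h * u).
    have -> : t *: (2%:R * h * u) = r * (a * (r * h) + b * k
       + t *: (h * u^`() - h^`() * u)) - (a * f + b * f^`() + t *:
       (r * h * u^`() - k * u)).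
      by rewrite f' -/k /k r1 -!mul_polyC /f; ring.
    by rewrite E subr0 dvdp_mulIl.
  have t0 : t = 0.
    apply/eqP; apply: contraTT rw => t0; rewrite dvdpZr // rE dvdp_XsubCl.
    by rewrite -coprimep_XsubC -rE coprimep_sym.
  move: cop; rewrite !coprimepMr => /andP[/andP[cr2 crh] _].
  have crk : coprimep (r * h) k.
    rewrite coprimepMl; apply/andP; split.
      rewrite [k](_ : _ = h^`() * r + 2%:R * h); last by rewrite /k r1; ring.
      by rewrite coprimep_addl_mul coprimepMr cr2.
    rewrite [k](_ : _ = (r^`() *+ 2) * h + r * h^`()); last by rewrite /k; ring.
    rewrite coprimep_addl_mul coprimepMr coprimep_sym crh.
    by move: sep; rewrite unlock.
  (* With t = 0, dividing the relation by r leaves a r h + b k = 0. Then r h divides b, whose size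
     is at most n, while r h has size n + 1. *)
  have rhb : r * h %| b.
    rewrite -(Gauss_dvdpl b crk) -(@dvdp_mul2l _ r) ?monic_neq0 //.
    have -> : r * (b * k) = - a * (r * (r * h)) + (a * f + b * f^`() + t *:
       (r * h * u^`() - k * u)).
      by rewrite f' -/k t0 scale0r /f; ring.
    by rewrite E addr0 dvdp_mull.
  have b0 : b = 0.
    apply/eqP; apply: contraTT rhb => b0; apply/negP => /(dvdp_leq b0).
    by rewrite size_rh j0 subn0 ltnNge sb.
  move: E; rewrite b0 t0 mul0r scale0r !addr0 !eqxx /= orbF => /eqP.
  by rewrite mulf_eq0 (negPf f0) orbF => ->.
(* If 2 h u vanishes at the root c of r, then c is a common root of f, f' and w. *)
rewrite /= rE coprimep_sym coprimep_XsubC negbK => c2hu.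
apply: (@det_common_root c).
- by rewrite /f rE -dvdp_XsubCl expr2 -mulrA dvdp_mulIl.
- by rewrite f' rE -dvdp_XsubCl dvdp_mulIl.
- rewrite -dvdp_XsubCl /w j0 expr0 mul1r -rE.
  have -> : r * h * u^`() - k * u = r * (h * u^`() - h^`() * u) - 2%:R * h * u.
    by rewrite /k r1; ring.
  by rewrite dvdp_sub ?dvdp_mulIl // rE dvdp_XsubCl.
Qed.

End SquareFactor.

(** * The discriminant modulo p^2 *)

Section Lift.
Variables (p : nat) (pr_p : prime p).
Local Notation Zp := (padic_int pr_p).
Local Notation redp := (map_poly (@red p pr_p)).

(** This digit lift is not additive; arguments go through [liftpK], and the values at 0 and 1
    preserve sizes and monicity. *)
Definition lift (a : 'F_p) : Zp := (a : nat)%:R.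

Lemma red_lift : cancel lift (@red p pr_p).
Proof. by move=> a; rewrite rmorph_nat natr_Zp. Qed.

Definition liftp (f : {poly 'F_p}) : {poly Zp} := map_poly lift f.

Lemma lift0 : lift 0 = 0. Proof. by []. Qed.

Lemma lift1 : lift 1 = 1. Proof. by []. Qed.

Lemma liftpK f : redp (liftp f) = f.
Proof. by apply/polyP => i; rewrite coef_map coef_map_id0 ?lift0 //= red_lift. Qed.

Lemma size_liftp f : size (liftp f) = size f.
Proof. by apply: size_map_inj_poly; first exact: can_inj red_lift. Qed.

Lemma liftp_monic f : f \is monic -> liftp f \is monic.
Proof.
rewrite !monicE !lead_coefE size_liftp coef_map_id0 ?lift0 // => /eqP ->.
by rewrite lift1.
Qed.

Lemma redp_p : redp p%:R = 0.
Proof. by rewrite rmorph_nat -polyC_natr pchar_Fp_0. Qed.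

Lemma redpD_p g k : redp (g + p%:R * k) = redp g.
Proof. by rewrite rmorphD rmorphM /= redp_p mul0r addr0. Qed.

Lemma poly_p_neq0 : p%:R != 0 :> {poly Zp}.
Proof. by rewrite -polyC_natr polyC_eq0 padic_p_neq0. Qed.

Lemma redp_eq0 g : redp g = 0 -> exists2 k, g = p%:R * k & size k = size g.
Proof.
move=> g0; have /choice[y yE] i : exists y, g`_i = p%:R * y.
  by apply: red_eq0; have := congr1 (fun h : {poly 'F_p} => h`_i) g0; rewrite coef_map coef0.
have gE : g = p%:R * \poly_(i < size g) y i.
  apply/polyP => i; rewrite -polyC_natr coefCM coef_poly.
  by case: ltnP => [_|/leq_sizeP->//]; rewrite ?mulr0.
exists (\poly_(i < size g) y i) => //.
by rewrite [in RHS]gE -polyC_natr size_Cmul ?padic_p_neq0.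
Qed.

Lemma redp_eq g h : redp g = redp h -> exists k, g = h + p%:R * k.
Proof.
move=> gh; have [|k kE _] := @redp_eq0 (g - h); first by rewrite rmorphB /= gh subrr.
by exists k; rewrite -kE addrC subrK.
Qed.

Lemma redp_monic g : g \is monic -> redp g \is monic.
Proof. exact: monic_map. Qed.

Lemma size_redp g : g \is monic -> size (redp g) = size g.
Proof. by move=> /eqP mg; rewrite size_map_poly_id0 // mg rmorph1 oner_neq0. Qed.

Lemma padic_natr_neq0 n : n.+1%:R != 0 :> Zp.
Proof.
apply/eqP => /(congr1 (fun x : Zp => residue x n.+1)); rewrite residue_natr.
move/(congr1 val); rewrite /= val_Zp_nat ?gt1_pX // modn_small //.
by rewrite (ltn_trans (ltn_expl _ (prime_gt1 pr_p))) // ltn_exp2l ?prime_gt1.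
Qed.

(** Characteristic 0 keeps the degree of f' even if p divides that of f, so [disc] is computed by
    the Sylvester matrix of the prescribed size. *)
Lemma size_deriv_padic n (f : {poly Zp}) : size f = n.+2 -> size f^`() = n.+1.
Proof.
move=> sf; have f0 : f != 0 by rewrite -size_poly_gt0 sf.
apply/eqP; rewrite eqn_leq -ltnS -sf lt_size_deriv //= ltnNge.
apply: contraTN isT => /leq_sizeP/(_ n (leqnn n)); rewrite coef_deriv => /eqP.
rewrite -mulr_natr mulf_eq0 (negPf (padic_natr_neq0 n)) orbF.
by rewrite -[n.+1]/(n.+2.-1) -sf -lead_coefE lead_coef_eq0 (negPf f0).
Qed.

End Lift.

Section Discriminant.
Variables (p : nat) (pr_p : prime p).
Local Notation Zp := (padic_int pr_p).
Local Notation redp := (map_poly (@red p pr_p)).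
Variables (n : nat) (r h u : {poly Zp}).
Hypotheses (mr : r \is monic) (mh : h \is monic) (sep : separable_poly (redp h)).
Hypotheses (sf0 : size (r ^+ 2 * h) = n.+2) (su : (size u <= n.+1)%N).
Let f := r ^+ 2 * h + p%:R * u.

Let sf : size f = n.+2.
Proof.
rewrite /f size_polyDl // sf0 -polyC_natr mul_polyC.
by rewrite ltnS (leq_trans (size_scale_leq _ _)).
Qed.

Let redf : redp f = redp r ^+ 2 * redp h.
Proof. by rewrite redpD_p rmorphM rmorphXn. Qed.

Let sfb : size (redp r ^+ 2 * redp h) = n.+2.
Proof. by rewrite -rmorphXn -rmorphM size_redp // monicMl ?monic_exp. Qed.

Let sub : (size (redp u) <= n.+1)%N.
Proof. by rewrite (leq_trans (size_poly _ _)). Qed.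

Let discE : disc f =
  (-1) ^+ 'C((size f).-1, 2) * \det (sylvester n n.+1 f f^`()).
Proof. by rewrite /disc (resultantE (m := n) (n := n.+1)) // (size_deriv_padic sf). Qed.

Let red_det (N : nat) (A : 'M[Zp]_N) : red (\det A) = \det (map_mx (@red p pr_p) A).
Proof. by rewrite det_map_mx. Qed.

Lemma disc_unit : redp r = 1 -> red (disc f) != 0.
Proof.
move=> r1; rewrite discE rmorphM rmorph_sign mulf_neq0 ?signr_eq0 //= red_det.
rewrite map_sylvester -deriv_map redf.
exact: det_sylvester_separable.
Qed.

(* The polynomial v = 'X^j r h is monic of degree n, and v f' - 'X^j k f = p w:
   this combination of rows can replace the last row of the Sylvester matrix. *)
Lemma disc_nonunit j : size r = j.+2 -> exists2 d, disc f = p%:R * d &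
  red d = 0 <-> ~~ ((j == 0%N) && coprimep (redp r) (2%:R * redp h * redp u)).
Proof.
move=> sr; pose k := r^`() * h *+ 2 + r * h^`().
pose w := 'X^j * (r * h * u^`() - k * u).
pose M := replace_row (last_row n n) (sylvester n n.+1 f f^`()) (poly_rV w).
pose c : 'rV_(n + n.+1) := row_mx (poly_rV (- 'X^j * k)) (poly_rV ('X^j * (r * h))).
have leq_jn := leq_size_sqrt mr mh sf0 sr.
have mv : 'X^j * (r * h) \is monic by rewrite monicMl ?monicXn // monicMl.
have sv : size ('X^j * (r * h)) = n.+1.
  rewrite size_Mmonic ?monic_neq0 ?monicXn ?monicMl // size_polyXn.
  by rewrite (size_sqrt_mul mr mh sf0 sr); lia.
exists ((-1) ^+ 'C((size f).-1, 2) * \det M).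
  rewrite discE mulrCA; congr (_ * _).
  apply: (@det_replace_last_row _ _ _ _ c) => [i||].
  - exact: last_row_max.
  - by rewrite row_mxEr mxE /= -[n]/(n.+1.-1) -sv -lead_coefE (eqP mv).
  rewrite mul_sylvester row_mxKl row_mxKr !poly_rV_K ?sv //; last first.
    rewrite mulNr size_polyN (leq_trans (size_polyMleq _ _)) // size_polyXn /=.
    have := size_deriv_sqrt mr mh sf0 sr; rewrite -/k.
    by move: leq_jn (size k); lia.
  rewrite -linearZ scaler_nat -mulr_natl; congr poly_rV.
  by rewrite /w /k /f derivD !derivM -polyC_natr derivC; ring.
rewrite rmorphM rmorph_sign /= red_det.
have -> : map_mx (@red p pr_p) M = replace_row (last_row n n)
    (sylvester n n.+1 (redp r ^+ 2 * redp h) (redp r ^+ 2 * redp h)^`())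
    (poly_rV ('X^j * (redp r * redp h * (redp u)^`() -
       ((redp r)^`() * redp h *+ 2 + redp r * (redp h)^`()) * redp u))).
  rewrite -redf deriv_map -map_sylvester.
  have -> : 'X^j * (redp r * redp h * (redp u)^`() -
       ((redp r)^`() * redp h *+ 2 + redp r * (redp h)^`()) * redp u) = redp w.
    rewrite /w /k !deriv_map rmorphM rmorphB !rmorphM rmorphD rmorphMn !rmorphM /=.
    by rewrite map_polyXn.
  rewrite -map_poly_rV; apply/matrixP => a b; rewrite !mxE.
  by case: ifP => _; rewrite ?mxE.
rewrite -(@det_replace_sylvester_square_eq0 _ n _ _ _ (redp_monic mr) (redp_monic mh)
  sep sfb sub j); last by rewrite size_redp.
by split=> [/eqP|->]; rewrite ?mulr0 // mulf_eq0 signr_eq0 => /eqP.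
Qed.

Lemma disc_ndvd : ~ padic_dvd p%:R (disc f) <-> size (redp r) = 1%N.
Proof.
rewrite padic_dvdP size_redp //; split=> [nd|r1].
  case sr: (size r) => [|[|j]] //.
    by move/eqP: sr; rewrite size_poly_eq0 (negPf (monic_neq0 mr)).
  have [d dE _] := disc_nonunit sr; case: nd; rewrite dE rmorphM /=.
  by rewrite red_p mul0r.
apply/eqP/disc_unit; have /size_poly1P[c _ rc] : size (redp r) == 1%N.
  by rewrite size_redp // r1.
by have := redp_monic mr; rewrite rc monicE lead_coefC => /eqP ->.
Qed.

Lemma disc_val1 : padic_val (disc f) 1 <->
  size (redp r) = 2%N /\ coprimep (redp r) (2%:R * redp h * redp u).
Proof.
rewrite size_redp // /padic_val expr1; case sr: (size r) => [|[|j]] //.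
- by move/eqP: sr; rewrite size_poly_eq0 (negPf (monic_neq0 mr)).
- split=> [[pd _]|[]//].
  by have /disc_ndvd : size (redp r) = 1%N by rewrite size_redp.
have [d dE dP] := disc_nonunit sr; rewrite dE.
split=> [[_ nd]|[[j0] cop]].
  have {nd} : red d <> 0.
    by move=> /red_eq0[e eE]; apply: nd; exists e; rewrite eE mulrA -expr2 mulrC.
  rewrite dP => /negP; rewrite negbK => /andP[/eqP -> cop]; by split.
split; first by exists d; rewrite mulrC.
move=> [e]; rewrite expr2 mulrCA => /(mulfI (padic_p_neq0 pr_p)) eE.
have /dP : red d = 0 by rewrite eE rmorphM /= red_p mulr0.
by rewrite j0 cop.
Qed.

End Discriminant.

(** * Orders *)

Section Orders.
Variables (S : idomainType) (A : comAlgType {fraction S}).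
Implicit Types (g h : {poly S}).
Local Notation "c *~: x" := (tofrac c *: x) (at level 40) : ring_scope.

Lemma order_closed (O : set A) : is_order O ->
  [/\ O 1, forall x y, O x -> O y -> O (x - y) & forall x y, O x -> O y -> O (x * y)].
Proof.
move=> [[one_O OB OM] _ _]; split=> [| x y | x y].
- exact: set_mem one_O.
- by move=> /mem_set Ox /mem_set Oy; apply/set_mem/OB.
- by move=> /mem_set Ox /mem_set Oy; apply/set_mem/OM.
Qed.

(** These hypotheses abstract A = Frac(S)[x]/(f), with [ev] sending g to g(x); they keep the
    quotient type out of the arguments. *)
Variables (ev : {rmorphism {poly S} -> A}) (f : {poly S}).
Hypotheses (mf : f \is monic) (evf : ev f = 0).
Hypothesis evC : forall c, ev c%:P = c *~: 1.
Hypothesis ev_ker : forall g, ev g = 0 -> exists v, g = v * f.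
Hypothesis ev_span : forall a : A, exists2 d : S, d != 0 & exists g, ev g = d *~: a.

Lemma evZ c g : ev (c%:P * g) = c *~: ev g.
Proof. by rewrite rmorphM evC -scalerAl mul1r. Qed.

Lemma tofrac_scalerI c (x y : A) : c != 0 -> c *~: x = c *~: y -> x = y.
Proof. by move=> c0; apply: scalerI; rewrite tofrac_eq0. Qed.

Lemma ev_sum_coef n g : (size g <= n)%N ->
  ev g = \sum_(i < n) g`_i *~: ev 'X^i.
Proof.
move=> sg; have -> : ev g = ev (\poly_(i < n) g`_i).
  by congr (ev _); apply/polyP => i; rewrite coef_poly; case: ltnP => // ni;
    rewrite nth_default // (leq_trans sg).
rewrite poly_def rmorph_sum; apply: eq_bigr => i _.
by rewrite -mul_polyC evZ.
Qed.

Lemma ev_mod g : ev g = ev (g %% f).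
Proof.
by rewrite {1}(Pdiv.IdomainMonic.divp_eq mf g) rmorphD rmorphM evf mulr0 add0r.
Qed.

Local Notation O := [set ev g | g in [set: {poly S}]]%classic.

Lemma ev_sum_mod g :
  ev g = \sum_(i < (size f).-1) (g %% f)`_i *~: ev 'X^i.
Proof.
rewrite ev_mod; apply: ev_sum_coef.
by have := ltn_modpN0 g (monic_neq0 mf); case: (size f).
Qed.

Lemma range_order : is_order O.
Proof.
split; first split.
- by apply/mem_set; exists 1; rewrite ?rmorph1.
- move=> x y /set_mem[g _ <-] /set_mem[h _ <-]; apply/mem_set.
  by exists (g - h); rewrite ?rmorphB.
- move=> x y /set_mem[g _ <-] /set_mem[h _ <-]; apply/mem_set.
  by exists (g * h); rewrite ?rmorphM.
- exists (size f).-1, (fun i => ev 'X^i); rewrite eqEsubset; split=> [x [g _ <-]|x [c _ <-]].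
    by exists (fun i => (g %% f)`_i) => //; rewrite ev_sum_mod.
  exists (\sum_(i < (size f).-1) (c i)%:P * 'X^i) => //; rewrite rmorph_sum.
  by apply: eq_bigr => i _; rewrite evZ.
- by move=> a; have [d d0 [g gE]] := ev_span a; exists d => //; exists g.
Qed.

(* The element th = g / q satisfies th^2 = b th - a c, so O + O th is an
   order; it is strictly larger than O. *)
Lemma not_maximal_order (q : S) (phi g a b c : {poly S}) : q != 0 ->
    f = phi * g + (q ^+ 2)%:P * c -> g = phi * a + q%:P * b ->
    (forall k v, g <> q%:P * k + v * f) ->
  ~ is_maximal_order O.
Proof.
move=> q0 fE gE gNO [_ maxO].
have qF0 : tofrac q != 0 by rewrite tofrac_eq0.
have [th qth] : exists th : A, q *~: th = ev g.
  by exists ((tofrac q)^-1 *: ev g); rewrite scalerA divff // scale1r.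
have th2 : th * th = ev b * th - ev (a * c).
  apply: (tofrac_scalerI q0); apply: (tofrac_scalerI q0).
  have -> : q *~: (q *~: (th * th)) = ev (g * g).
    by rewrite rmorphM -qth -scalerAl -scalerAr.
  rewrite scalerBr [q *~: (ev b * th)]scalerAr qth scalerBr -rmorphM -!evZ -rmorphB.
  (* Multiply g = phi a + q b by g and substitute phi g = f - q^2 c. *)
  rewrite -[RHS]addr0; have -> : g * g = q%:P * (b * g) - q%:P * (q%:P * (a * c)) + a * f.
    by rewrite {1}fE {1}gE rmorphXn /=; ring.
  have <- : ev (a * f) = 0 by rewrite rmorphM evf mulr0.
  exact: rmorphD.
pose O' : set A := [set ev z.1 + ev z.2 * th | z in [set: {poly S} * {poly S}]]%classic.
have sub : (O `<=` O')%classic.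
  by move=> x [h _ <-]; exists (h, 0) => //=; rewrite rmorph0 mul0r addr0.
have ordO' : is_order O'.
  split; first split.
  - apply/mem_set/sub; exists 1 => //; exact: rmorph1.
  - move=> x y /set_mem[z _ <-] /set_mem[t _ <-]; apply/mem_set.
    by exists (z.1 - t.1, z.2 - t.2) => //=; rewrite !rmorphB; ring.
  - move=> x y /set_mem[z _ <-] /set_mem[t _ <-]; apply/mem_set.
    exists (z.1 * t.1 - z.2 * t.2 * (a * c), z.1 * t.2 + z.2 * t.1 + z.2 * t.2 * b) => //=.
    have -> : (ev z.1 + ev z.2 * th) * (ev t.1 + ev t.2 * th) =
      ev z.1 * ev t.1 + (ev z.1 * ev t.2 + ev z.2 * ev t.1) * th
      + ev z.2 * ev t.2 * (th * th) by ring.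
    by rewrite th2 !rmorphD !rmorphN !rmorphM; ring.
  - pose n := (size f).-1.
    pose gen (i : 'I_(n + n)) := match fintype.split i with
      inl j => ev 'X^j | inr j => ev 'X^j * th end.
    have genE (cf : 'I_(n + n) -> S) : \sum_i cf i *~: gen i =
        \sum_(i < n) cf (lshift n i) *~: ev 'X^i
        + (\sum_(i < n) cf (rshift n i) *~: ev 'X^i) * th.
      rewrite big_split_ord /=; congr (_ + _).
        by apply: eq_bigr => i _; rewrite /gen (unsplitK (inl _)).
      rewrite mulr_suml; apply: eq_bigr => i _.
      by rewrite /gen (unsplitK (inr _)) scalerAl.
    exists (n + n)%N, gen; rewrite eqEsubset; split=> [x [z _ <-]|x [cf _ <-]].
      exists (fun i => match fintype.split i with
        inl j => (z.1 %% f)`_j | inr j => (z.2 %% f)`_j end) => //.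
      rewrite genE [ev z.1]ev_sum_mod [ev z.2]ev_sum_mod; congr (_ + _ * _).
        by apply: eq_bigr => i _; rewrite (unsplitK (inl _)).
      by apply: eq_bigr => i _; rewrite (unsplitK (inr _)).
    exists (\sum_(i < n) (cf (lshift n i))%:P * 'X^i,
            \sum_(i < n) (cf (rshift n i))%:P * 'X^i) => //=.
    rewrite genE !rmorph_sum; congr (_ + _ * _);
      by apply: eq_bigr => i _; rewrite evZ.
  - move=> x; have [d d0 [h hE]] := ev_span x; exists d => //.
    by apply: sub; exists h.
have Oth : O th.
  rewrite -(maxO _ ordO' sub); exists (0, 1) => //=.
  by rewrite rmorph0 rmorph1 add0r mul1r.
have [k _ kE] := Oth; have [|v vE] := @ev_ker (g - q%:P * k).
  by rewrite rmorphB /= evZ kE qth subrr.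
by apply: (gNO k v); rewrite -vE addrC subrK.
Qed.

(** Finite generation supplies one denominator for the whole order, in particular for all powers of
    one element. *)
Lemma order_denominator (O' : set A) : is_order O' ->
  exists2 d : S, d != 0 & forall x, O' x -> exists g, ev g = d *~: x.
Proof.
case=> _ [m [g O'E]] _.
have /choice[d dP] i : exists d : S, d != 0 /\ exists h, ev h = d *~: g i.
  by have [d d0 [h hE]] := ev_span (g i); exists d; split=> //; exists h.
exists (\prod_i d i); first by apply/prodf_neq0 => i _; have [] := dP i.
have /choice[h hE] i := (dP i).2.
rewrite O'E => x [c _ <-].
exists (\sum_i (c i * \prod_(j | j != i) d j)%:P * h i).
rewrite rmorph_sum scaler_sumr; apply: eq_bigr => i _ /=.
rewrite evZ hE !scalerA -!rmorphM; congr (tofrac _ *: _).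
by rewrite [in RHS](bigD1 i) //=; ring.
Qed.

End Orders.

Lemma irreducible_divisor (F : fieldType) (e : {poly F}) : (1 < size e)%N ->
  exists2 phi, irreducible_poly phi & phi %| e.
Proof.
have [n] := ubnP (size e); elim: n e => // n IHn e se e1.
have [irr|nirr] := pselect (irreducible_poly e); first by exists e.
have e0 : e != 0 by rewrite -size_poly_gt0 (leq_trans _ e1).
have [g [g1 ge nge]] : exists g : {poly F}, [/\ size g != 1%N, g %| e & ~ g %= e].
  apply: contrapT => nex; apply: nirr; split=> // g g1 ge.
  by apply: contrapT => nge; apply: nex; exists g.
have g0 : g != 0 by apply: contraNneq e0 => g0; rewrite g0 dvd0p in ge.
have ltg : (size g < size e)%N.
  rewrite ltn_neqAle dvdp_leq // andbT; apply: contra_notN nge => sge.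
  by rewrite -dvdp_size_eqp.
have [||phi irr phig] := IHn g.
- by rewrite (leq_trans ltg).
- by rewrite ltn_neqAle eq_sym g1 size_poly_gt0.
by exists phi => //; apply: dvdp_trans ge.
Qed.

Lemma irreducible_dvd_exp (F : fieldType) (phi g : {poly F}) m :
  irreducible_poly phi -> phi %| g ^+ m -> phi %| g.
Proof.
move=> irr; apply: contraTT; rewrite -irreducible_poly_coprime // => cop.
have [s1 _] := irr; apply/negP => dvd.
have : coprimep phi phi by apply: coprimep_dvdl dvd _; rewrite coprimep_expr.
by rewrite coprimepp gtn_eqF.
Qed.

(** * Dedekind's criterion *)

Section Dedekind.
Variables (p : nat) (pr_p : prime p).
Local Notation Zp := (padic_int pr_p).
Local Notation redp := (map_poly (@red p pr_p)).
Local Notation liftp := (@liftp p pr_p).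
Local Notation F := 'F_p.
Variables (A : comAlgType {fraction Zp}) (ev : {rmorphism {poly Zp} -> A}).
Variables (r h u : {poly Zp}).
Hypotheses (mr : r \is monic) (sep : separable_poly (redp h)).
Let f := r ^+ 2 * h + p%:R * u.
Hypotheses (mf : f \is monic) (evf : ev f = 0).
Hypothesis evC : forall c, ev c%:P = tofrac c *: 1.
Hypothesis ev_ker : forall g, ev g = 0 -> exists v, g = v * f.
Hypothesis ev_span : forall a : A,
  exists2 d : Zp, d != 0 & exists g, ev g = tofrac d *: a.

Local Notation pK := (tofrac (p%:R : Zp)).
Local Notation O := [set ev g | g in [set: {poly Zp}]]%classic.

Let ev_p g : ev (p%:R * g) = pK *: ev g.
Proof. by rewrite -polyC_natr (evZ evC). Qed.

Let p_inj (x y : A) : pK *: x = pK *: y -> x = y.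
Proof. exact: tofrac_scalerI (padic_p_neq0 pr_p). Qed.

Let redf : redp f = redp r ^+ 2 * redp h.
Proof. by rewrite redpD_p rmorphM rmorphXn. Qed.

Section Overorder.
Variable O' : set A.
Hypotheses (ordO' : is_order O') (sub : (O `<=` O')%classic).

Let subO g : O' (ev g). Proof. by apply: sub; exists g. Qed.

Let O'B x y : O' x -> O' y -> O' (x - y).
Proof. by have [_ cB _] := order_closed ordO'; apply: cB. Qed.

Let O'M x y : O' x -> O' y -> O' (x * y).
Proof. by have [_ _ cM] := order_closed ordO'; apply: cM. Qed.

Let O'D x y : O' x -> O' y -> O' (x + y).
Proof.
move=> Ox Oy; rewrite -[y]opprK -[- y]sub0r -(rmorph0 ev).
by apply: O'B => //; apply: O'B.
Qed.
Let O'Z c x : O' x -> O' (tofrac c *: x).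
Proof. by move=> Ox; rewrite -[x]mul1r scalerAl -evC; apply: O'M. Qed.
Let O'X x m : O' x -> O' (x ^+ m).
Proof.
by move=> Ox; elim: m => [|m IH]; [rewrite expr0 -(rmorph1 ev)|rewrite exprS; apply: O'M].
Qed.

(* The ideal of F_p[x] formed by the reductions of the g such that g(x) lies
   in p O'. *)
Let inI (g : {poly F}) := exists2 y, O' y & ev (liftp g) = pK *: y.

(** Changing G by p k moves ev G by p times an element of O, which lies in O'; the choice of lift is
    therefore immaterial. *)
Let inI_red G : inI (redp G) <-> exists2 y, O' y & ev G = pK *: y.
Proof.
have [k Gk] : exists k, G = liftp (redp G) + p%:R * k by apply: redp_eq; rewrite liftpK.
split=> -[y Oy yE].
  by exists (y + ev k); [exact: O'D | rewrite {1}Gk rmorphD /= ev_p yE scalerDr].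
exists (y - ev k); first exact: O'B.
rewrite scalerBr -yE -ev_p -rmorphB; congr (ev _).
by apply/eqP; rewrite eq_sym subr_eq -Gk.
Qed.

Let inI_mul k g : inI g -> inI (k * g).
Proof.
case=> y Oy yE; rewrite -[k](liftpK pr_p) -[g](liftpK pr_p) -rmorphM; apply/inI_red.
by exists (ev (liftp k) * y); [exact: O'M | rewrite rmorphM /= yE scalerAr].
Qed.

Let inI_add g k : inI g -> inI k -> inI (g + k).
Proof.
case=> y Oy yE [z Oz zE]; rewrite -[k](liftpK pr_p) -[g](liftpK pr_p) -rmorphD.
by apply/inI_red; exists (y + z); [exact: O'D | rewrite rmorphD /= yE zE scalerDr].
Qed.

Let inI_f : inI (redp f).
Proof.
by apply/inI_red; exists (ev 0); [exact: subO | rewrite evf rmorph0 scaler0].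
Qed.

(** Let d = p^k v, v a unit, be a common denominator of O'. If g(x) = p y, then v g(x)^(k+1) = p d
    y^(k+1) lies in p O, so g^(k+1) vanishes modulo p and f. *)
Let inI_nilpotent g : inI g -> exists m, redp f %| g ^+ m.
Proof.
case=> y Oy yE; have [d d0 dP] := order_denominator evC ev_span ordO'.
have [k [v [v0 dE]]] := padic_factor d0.
have [H HE] := dP _ (O'X k.+1 Oy).
have [|w wE] := @ev_ker (v%:P * liftp g ^+ k.+1 - p%:R * H).
  rewrite rmorphB /= (evZ evC) ev_p HE rmorphXn /= yE exprZn !scalerA.
  have -> : tofrac v * pK ^+ k.+1 = pK * tofrac d.
    by rewrite dE rmorphM rmorphXn /= exprS; ring.
  exact: subrr.
exists k.+1.
have /(congr1 (fun z => redp z)) : v%:P * liftp g ^+ k.+1 = w * f + p%:R * H.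
  by rewrite -wE subrK.
rewrite redpD_p !rmorphM rmorphXn /= liftpK map_polyC /= mul_polyC => E.
by rewrite -(dvdpZr _ _ v0) E dvdp_mull.
Qed.

(* If O' is larger than O, the ideal inI contains redp f / phi for some
   irreducible phi.  Its elements being nilpotent modulo redp f, phi divides r,
   and u being prime to phi makes phi(x) invertible in O' / p O'.  Then inI is
   stable under division by phi, while phi divides all its elements. *)
Lemma over_order_eq : coprimep (redp r) (redp u) -> O' = O.
Proof.
move=> cru; apply: contrapT => neq.
have [y0 Oy0 nOy0] : exists2 y0, O' y0 & ~ O y0.
  apply: contrapT => nex; apply: neq; rewrite eqEsubset; split=> // x Ox.
  by apply: contrapT => nOx; apply: nex; exists x.
(* Multiply y0 by p until the next multiple falls into O. *)
have [y [Oy nOy [G GE]]] : exists y, [/\ O' y, ~ O y & exists G, ev G = pK *: y].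
  have [d d0 dP] := order_denominator evC ev_span ordO'.
  have [k [v [/red_unit v1 dE]]] := padic_factor d0.
  have : exists g, ev g = pK ^+ k *: y0.
    have [g gE] := dP _ Oy0; exists (v^-1%:P * g).
    by rewrite (evZ evC) gE dE scalerA -rmorphM mulrCA mulVr // mulr1 rmorphXn.
  elim: k {dE} => [|k IHk] [g gE].
    by case: nOy0; exists g => //; rewrite gE expr0 scale1r.
  have [ex|nex] := pselect (exists g, ev g = pK ^+ k *: y0); first exact: IHk.
  exists (pK ^+ k *: y0); split.
  - by rewrite -rmorphXn; apply: O'Z.
  - by case=> z _ zE; apply: nex; exists z.
  - by exists g; rewrite gE exprS scalerA.
have mfb := redp_monic mf; have fb0 := monic_neq0 mfb.
have nfG : ~~ (redp f %| redp G).
  apply/negP => /dvdpP[k kE]; apply: nOy.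
  have [|l lE] := @redp_eq _ pr_p G (liftp k * f); first by rewrite rmorphM /= liftpK.
  exists l => //; apply: p_inj; rewrite -GE lE rmorphD rmorphM /= evf mulr0 add0r.
  by rewrite ev_p.
have IG : inI (redp G) by apply/inI_red; exists y.
pose d := gcdp (redp G) (redp f).
have Id : inI d.
  have [[a b] /= /eqpP[[c1 c2] /andP[/= c10 c20] cE]] := Bezoutp (redp G) (redp f).
  have -> : d = (c2^-1 * c1)%:P * (a * redp G + b * redp f).
    by rewrite mul_polyC -scalerA cE scalerA mulVf // scale1r.
  by apply: inI_mul; apply: inI_add; apply: inI_mul.
have /dvdpP[e eE] : d %| redp f by apply: dvdp_gcdr.
have e1 : (1 < size e)%N.
  have e0 : e != 0 by apply: contraNneq fb0 => e0; rewrite eE e0 mul0r.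
  rewrite ltn_neqAle eq_sym size_poly_gt0 e0 andbT; apply: contra nfG => se.
  have /size_poly1P[c c0 ce] := se.
  by rewrite eE ce mul_polyC dvdpZl // dvdp_gcdl.
have [phi irr /dvdpP[e' e'E]] := irreducible_divisor e1.
have [phi1 _] := irr.
pose t := e' * d; have ft : redp f = phi * t by rewrite eE e'E /t; ring.
have It : inI t by apply: inI_mul.
(* redp f divides a power of t, hence so does phi; thus phi^2 divides redp f = phi t. *)
have phit : phi %| t.
  have [m /(dvdp_trans _) fm] := inI_nilpotent It.
  by apply: (@irreducible_dvd_exp _ _ _ m) => //; apply: fm; rewrite ft dvdp_mulr.
have phir : phi %| redp r.
  apply: contraLR isT => nr; rewrite -irreducible_poly_coprime // in nr.
  have : phi ^+ 2 %| redp h.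
    rewrite -(@Gauss_dvdpr _ _ (redp r ^+ 2)) ?coprimep_expl ?coprimep_expr //.
    by rewrite -redf ft expr2 dvdp_mul.
  by move=> phi2; have := (separable_squareP _).1 sep phi; rewrite gtn_eqF // phi2 => /(_ isT).
have [s sE] := dvdpP _ _ phir.
have [|v vE] := @redp_eq _ pr_p r (liftp phi * liftp s).
  by rewrite rmorphM /= !liftpK mulrC.
(* This lift of t is chosen so that phi T = f - p (u + p v^2 h) holds exactly over Z_p. *)
pose T := liftp phi * liftp s ^+ 2 * h + p%:R * (2%:R * v * liftp s * h).
have phi0 : phi != 0 by rewrite -size_poly_gt0 (leq_trans _ phi1).
have redT : redp T = t.
  apply: (mulfI phi0); rewrite -ft redf redpD_p !rmorphM /= !liftpK sE; ring.
have [y' Oy' y'E] : exists2 y, O' y & ev T = pK *: y by apply/inI_red; rewrite redT.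
have phiy' : ev (liftp phi) * y' = - ev (u + p%:R * (v ^+ 2 * h)).
  apply: p_inj; rewrite scalerAr -y'E -rmorphM scalerN -ev_p -rmorphN.
  have -> : liftp phi * T = f + (- (p%:R * (u + p%:R * (v ^+ 2 * h)))).
    by rewrite /f vE /T; ring.
  by rewrite rmorphD /= evf add0r.
have cphiu : coprimep phi (redp u) by apply: coprimep_dvdr phir cru.
have /Bezout_eq1_coprimepP[[a b] /= abE] := cphiu.
have [|w wE] := @redp_eq _ pr_p
    (liftp a * liftp phi + liftp b * (u + p%:R * (v ^+ 2 * h))) 1.
  by rewrite rmorphD !rmorphM /= redpD_p !liftpK abE rmorph1.
(* From a phi + b u = 1 modulo p and phi(x) y' = - u(x) modulo p, the element a(x) - b(x) y' inverts
   phi(x) modulo p O'. *)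
pose z := ev (liftp a) - ev (liftp b) * y'.
have Oz : O' z by apply: O'B => //; apply: O'M.
have phiz : ev (liftp phi) * z = 1 + pK *: ev w.
  rewrite -ev_p -(rmorph1 ev) -rmorphD -wE rmorphD [ev (_ * liftp phi)]rmorphM.
  rewrite [ev (liftp b * _)]rmorphM -[X in _ + _ * X]opprK -phiy' /z; ring.
have inI_div c : inI (phi * c) -> inI c.
  rewrite -[phi](liftpK pr_p) -[c](liftpK pr_p) -rmorphM => /inI_red[x Ox xE].
  apply/inI_red; exists (x * z - ev w * ev (liftp c)).
    by apply: O'B; apply: O'M.
  rewrite scalerBr scalerAl -xE rmorphM /= mulrAC phiz.
  by rewrite mulrDl mul1r -scalerAl addrK.
(* Descent on the size: a nonzero c in the ideal is nilpotent modulo redp f, so phi divides it, and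
   the quotient is still in the ideal. *)
have absurd m (c : {poly F}) : (size c < m)%N -> c != 0 -> inI c -> False.
  elim: m c => // m IHm c sc c0 Ic; have [l fl] := inI_nilpotent Ic.
  have /dvdpP[c' c'E] : phi %| c.
    apply: (@irreducible_dvd_exp _ _ _ l) => //.
    by apply: dvdp_trans fl; rewrite ft dvdp_mulr.
  have c'0 : c' != 0 by apply: contraNneq c0 => c'0; rewrite c'E c'0 mul0r.
  apply: (IHm c') => //; last by apply: inI_div; rewrite mulrC -c'E.
  by move: sc; rewrite c'E size_mul //; move: (size c') (size phi) phi1; clear; lia.
apply: (absurd (size (redp f)).+1 (redp f)) => //.
Qed.

End Overorder.

Lemma dedekind_maximal : is_maximal_order O <-> coprimep (redp r) (redp u).
Proof.
split=> [max|cru]; last first.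
  split=> [|O' ordO' sub]; first exact: (range_order mf evf evC ev_span).
  exact: over_order_eq.
apply: contrapT => /negP ncop.
have mfb := redp_monic mf.
have [d [md /dvdpP[s sE] gd]] := eqp_monic_gcd (redp u) (monic_neq0 (redp_monic mr)).
have d1 : (1 < size d)%N.
  rewrite ltn_neqAle eq_sym size_poly_gt0 monic_neq0 // andbT.
  by move: ncop; rewrite /coprimep (eqp_size gd).
have /dvdpP[x xE] : d %| redp u by rewrite -(eqp_dvdl _ gd) dvdp_gcdr.
have [|v vE] := @redp_eq _ pr_p r (liftp d * liftp s).
  by rewrite rmorphM /= !liftpK mulrC.
have [|y yE] := @redp_eq _ pr_p u (liftp d * liftp x).
  by rewrite rmorphM /= !liftpK mulrC.
(* Expanding (d s + p v)^2 h + p (d x + p y) and factoring d out of all terms not divisible by p^2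
   gives f = d g + p^2 (v^2 h + y), with g = d s^2 h + p b. *)
pose b := 2%:R * liftp s * v * h + liftp x.
pose g := liftp d * (liftp s ^+ 2 * h) + p%:R * b.
have fE : f = liftp d * g + p%:R ^+ 2 * (v ^+ 2 * h + y).
  by rewrite /f yE vE /g /b; ring.
have gb : redp f = d * redp g.
  by rewrite fE expr2 -mulrA redpD_p rmorphM /= liftpK.
apply: (@not_maximal_order _ _ ev f mf evf evC ev_ker ev_span p%:R (liftp d) g
  (liftp s ^+ 2 * h) b (v ^+ 2 * h + y) _ _ _ _ max).
- exact: padic_p_neq0.
- by rewrite fE rmorphXn /= polyC_natr.
- by rewrite polyC_natr.
(* Otherwise redp f would divide redp g, a nonzero polynomial of smaller degree because d is not
   constant. *)
move=> k l gE; have : redp f %| redp g.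
  rewrite gE polyC_natr [_ + l * f]addrC (redpD_p (l * f)) [redp (l * f)]rmorphM.
  exact: dvdp_mull.
have g0 : redp g != 0.
  by apply: contraTneq (monic_neq0 mfb) => g0; rewrite gb g0 mulr0 eqxx.
move/(dvdp_leq g0); rewrite gb size_mul ?(monic_neq0 md) ?g0 //.
by have := size_poly_gt0 (redp g); rewrite g0; move: (size d) (size (redp g)) d1; clear; lia.
Qed.

End Dedekind.

(** * The equation order inside the quotient algebra *)

Section EquationOrder.
Variables (S : idomainType) (f : {poly S}).
Hypotheses (mf : f \is monic) (sf : (1 < size f)%N).

Let ev : {rmorphism {poly S} -> {poly %/ poly_frac f}} :=
  in_qpoly (poly_frac f) \o @poly_frac S.

Lemma size_poly_frac (g : {poly S}) : size (poly_frac g) = size g.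
Proof.
apply: size_map_inj_poly; rewrite ?tofrac0 // => x y /eqP.
by rewrite tofrac_eq => /eqP.
Qed.

Let mff : poly_frac f \is monic. Proof. exact: monic_map. Qed.

(** The quotient type divides by [mk_monic], which returns its argument only when this is monic and
    nonconstant. *)
Let mkf : mk_monic (poly_frac f) = poly_frac f.
Proof. by rewrite /mk_monic size_poly_frac sf mff. Qed.

Lemma in_qpoly_polyC c : ev c%:P = tofrac c *: 1.
Proof.
rewrite /ev /= /poly_frac map_polyC /= -[_%:P]mulr1 mul_polyC in_qpolyZ.
by rewrite in_qpoly1.
Qed.

Lemma in_qpoly_eq0 g : ev g = 0 -> exists v, g = v * f.
Proof.
rewrite {1}(Pdiv.IdomainMonic.divp_eq mf g) => E; exists (g %/ f).
rewrite {1}(Pdiv.IdomainMonic.divp_eq mf g) -[RHS]addr0; congr (_ + _).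
have : ev (g %% f) = 0.
  rewrite -E rmorphD rmorphM [X in _ * X](_ : _ = 0) ?mulr0 ?add0r //.
  by apply: val_inj; rewrite /= mkf Pdiv.RingMonic.rmodpp.
move/(congr1 val); rewrite /= mkf Pdiv.Ring.rmodp_small; last first.
  by rewrite !size_poly_frac ltn_modpN0 ?monic_neq0.
by move=> E0; apply/eqP; rewrite -size_poly_eq0 -size_poly_frac [poly_frac _]E0 size_poly0.
Qed.

Lemma in_qpoly_self : ev f = 0.
Proof. by apply: val_inj; rewrite /= mkf Pdiv.RingMonic.rmodpp. Qed.

Lemma fraction_denominator (x : {fraction S}) :
  exists2 d : S, d != 0 & exists c, tofrac c = tofrac d * x.
Proof.
elim/quotW: x => r; exists (frac r).2; rewrite ?denom_ratioP //.
exists (frac r).1; unlock tofrac; rewrite -[RHS]FracField.pi_mul.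
apply/eqmodP; rewrite /= FracField.equivfE /FracField.mulf !numden_Ratio;
  rewrite ?mul1r ?oner_neq0 ?denom_ratioP //.
by rewrite mulrC.
Qed.

Lemma in_qpoly_span (a : {poly %/ poly_frac f}) :
  exists2 d : S, d != 0 & exists g, ev g = tofrac d *: a.
Proof.
have /choice[d dP] i : exists d : S,
    d != 0 /\ exists c, tofrac c = tofrac d * (a : {poly _})`_i.
  have [d d0 [c cE]] := fraction_denominator (a : {poly _})`_i.
  by exists d; split=> //; exists c.
have /choice[c cE] i := (dP i).2.
pose m := size (a : {poly {fraction S}}).
exists (\prod_(i < m) d i); first by apply/prodf_neq0 => i _; have [] := dP i.
exists (\poly_(i < m) (c i * \prod_(j < m | j != i :> nat) d j)).
have -> : tofrac (\prod_(i < m) d i) *: a =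
    in_qpoly (poly_frac f) (tofrac (\prod_(i < m) d i) *: (a : {poly _})).
  rewrite in_qpolyZ; congr (_ *: _); apply/esym/val_inj.
  exact: in_qpoly_small (size_mk_monic a).
rewrite /ev /=; congr (in_qpoly _ _); apply/polyP => i.
rewrite coef_map coefZ coef_poly; case: ltnP => [im|mi]; last first.
  by rewrite nth_default // mulr0 /= tofrac0.
rewrite /= [in RHS](bigD1 (Ordinal im)) //= !rmorphM /= cE.
by rewrite mulrAC.
Qed.

End EquationOrder.

Section DedekindPadic.
Variables (p : nat) (pr_p : prime p).
Local Notation redp := (map_poly (@red p pr_p)).

Lemma dedekind_criterion (r h u : {poly padic_int pr_p}) :
    r \is monic -> separable_poly (redp h) ->
    r ^+ 2 * h + p%:R * u \is monic -> (1 < size (r ^+ 2 * h + p%:R * u)%R)%N ->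
  is_maximal_order (@equation_order _ (r ^+ 2 * h + p%:R * u)) <->
  coprimep (redp r) (redp u).
Proof.
move=> mr sep mf sf.
exact: (dedekind_maximal mr sep mf (in_qpoly_self mf sf) (@in_qpoly_polyC _ _)
  (in_qpoly_eq0 mf sf) (@in_qpoly_span _ _)).
Qed.

End DedekindPadic.

(** * Haar measure of the cosets of p^2 Z_p^n *)

Section Haar.
Variables (R : realType) (p : nat) (pr_p : prime p) (n : nat).
Local Notation Zp := (padic_int pr_p).
Local Notation V := 'rV[Zp]_n.
Local Notation redp := (map_poly (@red p pr_p)).
Local Notation F := 'F_p.
Local Notation T := ('rV[F]_n * 'rV[F]_n)%type.

Lemma padic_residueM (x y : Zp) k :
  residue (x * y) k = residue x k * residue y k.
Proof. by []. Qed.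

(** Because of the index shift, level 1 is reduction modulo p^2. *)
Lemma residue1_eq0 (x : Zp) : residue x 1 = 0 <-> exists w, x = p%:R ^+ 2 * w.
Proof.
split=> [x1|[w ->]]; last first.
  rewrite padic_residueM -natrX residue_natr (_ : (p ^ 2)%N%:R = 0) ?mul0r //.
  by apply: val_inj; rewrite /= val_Zp_nat ?gt1_pX // modnn.
have /red_eq0[y yE] : red x = 0.
  rewrite /red -(Fp_nat_mod pr_p) -(residue0_modn x 1) x1.
  by rewrite mod0n.
have /red_eq0[w wE] : red y = 0; last by exists w; rewrite yE wE mulrA.
rewrite /red -(Fp_nat_mod pr_p) -(residue0_modn y 1).
have : (p ^ 2 %| p * residue y 1)%N.
  have /(congr1 (@nat_of_ord _)) := x1; rewrite yE padic_residueM.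
  rewrite residue_natr (residueM pr_p) val_Zp_nat ?gt1_pX // modnMml => /= E.
  exact/eqP.
move: (nat_of_ord _) => m; rewrite expnS expn1 dvdn_pmul2l ?prime_gt0 // => /eqP ->.
by [].
Qed.

(** The translate is written as an image so that the invariance clause of [is_haar] applies to it as
    it stands. *)
Definition coset2 (v : V) : set V :=
  [set v + w | w in [set p%:R ^+ 2 *: z | z in [set: V]]]%classic.

Lemma coset2P (v a : V) : coset2 v a <-> forall i, residue (a 0 i) 1 = residue (v 0 i) 1.
Proof.
split=> [[_ [w _ <-] <-] i|E].
  rewrite !mxE -[LHS]/(residue _ 1 + residue _ 1).
  have -> : residue (p%:R ^+ 2 * w 0 i) 1 = 0 by apply/residue1_eq0; exists (w 0 i).
  exact: addr0.
have /choice[w wE] i : exists w, a 0 i - v 0 i = p%:R ^+ 2 * w.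
  apply/residue1_eq0; rewrite -[LHS]/(residue _ 1 - residue _ 1).
  by rewrite E subrr.
exists (p%:R ^+ 2 *: \row_i w i); first by exists (\row_i w i).
by apply/rowP => i; rewrite !mxE -wE addrC subrK.
Qed.

Lemma open_coset2 v : open (coset2 v).
Proof.
rewrite openE => a /coset2P av.
exists (fun i j => padic_ball (a i j) 1) => [i j|b ab].
  have oB : padic_open (padic_ball (a i j) 1).
    by move=> y ya; exists 1%N => z; rewrite /padic_ball /= ya.
  by apply: open_nbhs_nbhs; split=> //; exact: oB.
by apply/coset2P => i; rewrite -av; apply: ab.
Qed.

Variable mu : {measure set (borel_rV pr_p n) -> \bar R}.
Hypothesis haar_mu : is_haar mu.

Lemma measurable_coset2 v : measurable (coset2 v : set (borel_rV pr_p n)).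
Proof. by apply: sub_gen_smallest; exact: open_coset2. Qed.

Lemma mu_coset2 v : mu (coset2 v) = mu (coset2 0).
Proof.
have [_ _ muD] := haar_mu; rewrite -[RHS](muD v); last exact: measurable_coset2.
congr (mu _); rewrite eqEsubset; split=> a.
  move=> [w wE <-]; exists w => //; exists w => //; exact: add0r.
by move=> [_ [w wE <-] <-]; exists w => //; rewrite add0r.
Qed.

Variable base : T -> V.
Hypothesis base_cover : forall a, exists t, coset2 (base t) a.
Hypothesis base_disj : forall t t' a, coset2 (base t) a -> coset2 (base t') a -> t = t'.

Let cells (s : seq T) : set (borel_rV pr_p n) :=
  [set a | exists2 t, t \in s & coset2 (base t) a]%classic.

Let measurable_cells s : measurable (cells s).
Proof.
elim: s => [|t s IHs].
  by rewrite (_ : cells [::] = set0); [exact: measurable0 | rewrite -subset0 => a []].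
rewrite (_ : cells (t :: s) = coset2 (base t) `|` cells s)%classic.
  by apply: measurableU => //; exact: measurable_coset2.
rewrite eqEsubset; split=> a => [[t']|].
  by rewrite inE => /predU1P[->|t's] at'; [left|right; exists t'].
case=> [at_|[t' t's at']]; first by exists t; rewrite ?mem_head.
by exists t' => //; rewrite inE t's orbT.
Qed.

Let mu_cells s : uniq s -> mu (cells s) = ((size s)%:R%:E * mu (coset2 0))%E.
Proof.
elim: s => [_|t s IHs /andP[ts us]].
  rewrite (_ : cells [::] = set0); last by rewrite -subset0 => a [].
  by rewrite measure0 mul0e.
rewrite (_ : cells (t :: s) = coset2 (base t) `|` cells s)%classic; last first.
  rewrite eqEsubset; split=> a => [[t']|].
    by rewrite inE => /predU1P[->|t's] at'; [left|right; exists t'].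
  case=> [at_|[t' t's at']]; first by exists t; rewrite ?mem_head.
  by exists t' => //; rewrite inE t's orbT.
have -> : mu (coset2 (base t) `|` cells s)%classic = (mu (coset2 (base t)) + mu (cells s))%E.
  apply: measureU => //; first exact: measurable_coset2.
  rewrite -subset0 => a [at_ [t' t's /(base_disj at_) tt']].
  by move: ts; rewrite tt' t's.
by rewrite IHs // mu_coset2 /= -natr1 EFinD addeC ge0_muleDl ?mul1e //.
Qed.

(** All cells have the same measure, which cancels in the quotient. The property P is only compared
    with [QP] inside W. *)
Lemma density_cells (W P : set V) (QW QP : {set T}) :
    (forall t a, coset2 (base t) a -> W a <-> t \in QW) ->
    (forall t a, coset2 (base t) a -> W a -> P a <-> t \in QP) ->
    QP \subset QW ->
  density mu W P = #|QP|%:R / #|QW|%:R.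
Proof.
move=> WP PP sQ; have [mu_gt0 mu_fin _] := haar_mu.
have cellsE (B : set V) (Q : {set T}) :
    (forall t a, coset2 (base t) a -> B a <-> t \in Q) -> B = cells (enum Q).
  move=> BQ; rewrite eqEsubset; split=> a.
    have [t ta] := base_cover a; move/(BQ _ _ ta) => tQ.
    by exists t; rewrite ?mem_enum.
  by move=> [t]; rewrite mem_enum => tQ ta; apply/(BQ _ _ ta).
have muQ (B : set V) (Q : {set T}) :
    (forall t a, coset2 (base t) a -> B a <-> t \in Q) ->
    mu B = (#|Q|%:R%:E * mu (coset2 0))%E.
  by move=> /cellsE ->; rewrite mu_cells ?enum_uniq // -cardE.
have muV : mu setT = (#|[set: T]|%:R%:E * mu (coset2 0))%E.
  by apply: muQ => t a _; rewrite inE.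
have m_fin : mu (coset2 0) \is a fin_num.
  rewrite ge0_fin_numE // (le_lt_trans _ mu_fin) // le_measure ?inE //.
  exact: measurable_coset2.
(* Finitely many cells of this measure fill the space, whose mass is positive. *)
have m_neq0 : fine (mu (coset2 0)) != 0.
  apply: contraTneq mu_gt0 => m0; rewrite muV -(fineK m_fin) m0 mule0.
  by rewrite ltxx.
rewrite /density (muQ W QW) // (muQ (W `&` P)%classic QP); last first.
  move=> t a ta; split=> [[Wa Pa]|tQ]; first exact/(PP t a ta Wa).
  have Wa : W a by apply/(WP t a ta); apply: (fintype.subsetP sQ).
  by split=> //; apply/(PP t a ta Wa).
rewrite -(fineK m_fin) -!EFinM /= invfM mulrACA divff // mulr1 //.
Qed.

End Haar.

(** * The densities *)

Section Digits.
Variables (p : nat) (pr_p : prime p) (n : nat).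
Local Notation Zp := (padic_int pr_p).
Local Notation V := 'rV[Zp]_n.
Local Notation redp := (map_poly (@red p pr_p)).
Local Notation liftp := (@liftp p pr_p).
Local Notation F := 'F_p.
Local Notation T := ('rV[F]_n * 'rV[F]_n)%type.

Definition sqrt_lift (x : 'rV[F]_n) := liftp (sqrt_part (monic_poly x)).
Definition sqfree_lift (x : 'rV[F]_n) := liftp (sqfree_part (monic_poly x)).

Lemma sqrt_lift_spec x :
  [/\ sqrt_lift x \is monic, sqfree_lift x \is monic,
      separable_poly (redp (sqfree_lift x)),
      size (sqrt_lift x ^+ 2 * sqfree_lift x) = n.+1 &
      redp (sqrt_lift x ^+ 2 * sqfree_lift x) = monic_poly x].
Proof.
have [mr mh sh xE] := sqrt_part_spec (monic_polyP x).
have mr' := liftp_monic pr_p mr; have mh' := liftp_monic pr_p mh.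
have E : redp (sqrt_lift x ^+ 2 * sqfree_lift x) = monic_poly x.
  by rewrite rmorphM rmorphXn /= !liftpK -xE.
split=> //; first by rewrite liftpK.
by rewrite -(size_redp (pr_p := pr_p)) ?monicMl ?monic_exp // E size_monic_poly.
Qed.

Definition cell_base (t : T) : V := coef_rV n
  (sqrt_lift t.1 ^+ 2 * sqfree_lift t.1 + p%:R * liftp (rVpoly t.2)).

Lemma cell_baseE t : monic_poly (cell_base t) =
  sqrt_lift t.1 ^+ 2 * sqfree_lift t.1 + p%:R * liftp (rVpoly t.2).
Proof.
have [mr mh sh sz _] := sqrt_lift_spec t.1.
have st : (size (p%:R * liftp (rVpoly t.2))%R < n.+1)%N.
  rewrite -polyC_natr mul_polyC ltnS (leq_trans (size_scale_leq _ _)) // size_liftp.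
  exact: size_poly.
rewrite coef_rVK //; last by rewrite size_polyDl // sz.
rewrite monicE lead_coefDl ?sz //.
by have := monicMl (sqfree_lift t.1) (monic_exp 2 mr); rewrite mh monicE.
Qed.

(** A translation by p^2 K is absorbed into U as p K, which does not affect the reduction of U. *)
Lemma coset2_cell_base t a : coset2 (cell_base t) a -> exists U : {poly Zp},
  [/\ (size U <= n)%N, redp U = rVpoly t.2 &
      monic_poly a = sqrt_lift t.1 ^+ 2 * sqfree_lift t.1 + p%:R * U].
Proof.
case=> _ [w _ <-] <-; pose K : {poly Zp} := \sum_(i < n) w 0 i *: 'X^(n - i.+1).
exists (liftp (rVpoly t.2) + p%:R * K); split.
- rewrite (leq_trans (size_polyD _ _)) // geq_max size_liftp size_poly.
  rewrite -polyC_natr mul_polyC (leq_trans (size_scale_leq _ _)) //.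
  exact: size_monic_poly_tail.
- by rewrite redpD_p liftpK.
rewrite mulrDr addrA -cell_baseE /monic_poly -addrA; congr (_ + _).
rewrite mulr_sumr mulr_sumr -big_split; apply: eq_bigr => i _.
rewrite !mxE scalerDl; congr (_ + _); rewrite -!mul_polyC -polyC_natr !polyCM.
by ring.
Qed.

Lemma redp_cell t a : coset2 (cell_base t) a -> redp (monic_poly a) = monic_poly t.1.
Proof.
case/coset2_cell_base => U [_ _ ->]; rewrite redpD_p.
by have [_ _ _ _ ->] := sqrt_lift_spec t.1.
Qed.

(** The reduction of f determines the first component, hence the lifts R and H; cancelling p then
    determines U and its reduction. *)
Lemma cell_disj t t' a :
  coset2 (cell_base t) a -> coset2 (cell_base t') a -> t = t'.
Proof.
move=> ta t'a; have E1 : t.1 = t'.1.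
  by apply: monic_poly_inj; rewrite -(redp_cell ta) (redp_cell t'a).
have [U [_ rU aE]] := coset2_cell_base ta.
have [U' [_ rU' aE']] := coset2_cell_base t'a.
have UU' : U = U'.
  apply: (mulfI (poly_p_neq0 pr_p)); apply: (addrI (sqrt_lift t.1 ^+ 2 * sqfree_lift t.1)).
  by rewrite -aE aE' E1.
have E2 : t.2 = t'.2 by apply: (can_inj rVpolyK); rewrite -rU UU'.
by case: (t) (t') E1 E2 => [? ?] [? ?] /= -> ->.
Qed.

Lemma cell_cover a : exists t, coset2 (cell_base t) a.
Proof.
pose x := map_mx (@red p pr_p) a.
have xE : redp (monic_poly a) = monic_poly x.
  rewrite rmorphD /= map_polyXn rmorph_sum; congr (_ + _).
  by apply: eq_bigr => i _; rewrite /= map_polyZ map_polyXn mxE.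
have [mr mh sh sz rE] := sqrt_lift_spec x.
set f0 := sqrt_lift x ^+ 2 * _ in sz rE.
have mf0 : f0 \is monic by rewrite monicMl ?monic_exp.
have [|U UE sU] := @redp_eq0 _ pr_p (monic_poly a - f0).
  by rewrite rmorphB /= xE rE subrr.
(* The leading terms of two monic polynomials of degree n cancel. *)
have {}sU : (size U <= n)%N.
  rewrite sU; apply/leq_sizeP => j; rewrite coefB leq_eqVlt => /predU1P[<-|nj].
    have := monic_polyP a; have := mf0; rewrite !monicE !lead_coefE sz size_monic_poly.
    by move=> /eqP -> /eqP ->; rewrite subrr.
  by rewrite !nth_default ?subrr ?sz ?size_monic_poly.
have sr : (size (redp U) <= n)%N by rewrite (leq_trans (size_poly _ _)).
have [|K KE] := @redp_eq _ pr_p U (liftp (redp U)); first by rewrite liftpK.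
exists (x, poly_rV (redp U)); exists (p%:R ^+ 2 *: \row_i K`_(n - i.+1)).
  by exists (\row_i K`_(n - i.+1)).
have aE : monic_poly a = f0 + p%:R * liftp (redp U) + p%:R ^+ 2 * K.
  by rewrite -[LHS](subrK f0) UE {1}KE; ring.
apply/rowP => i; rewrite !mxE /= poly_rV_K // -(coef_monic_poly a) aE [RHS]coefD.
congr (_ + _).
by rewrite -polyC_natr -polyC_exp coefCM.
Qed.

Lemma sqrt_part_size1 (x : 'rV[F]_n) :
  size (sqrt_part (monic_poly x)) = 1%N <-> separable_poly (monic_poly x).
Proof.
have [mr _ sh xE] := sqrt_part_spec (monic_polyP x).
split=> [/eqP/size_poly1P[c _ rc]|sx].
  have r1 : sqrt_part (monic_poly x) = 1.
    by move: mr; rewrite rc monicE lead_coefC => /eqP ->.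
  by rewrite xE r1 expr1n mul1r.
have := sqrt_partE (monic1 _) (monic_polyP x) sx.
by rewrite expr1n mul1r => ->; rewrite size_poly1.
Qed.

Lemma unit_const_cell t a : coset2 (cell_base t) a ->
  unit_const pr_p n a <-> t.1 \in const_neq0 F n.
Proof.
move=> ta; rewrite /unit_const /= padic_dvdP inE -(redp_cell ta) coef_map /=.
by split=> [/eqP|/eqP].
Qed.

Lemma maximal_cell t a : (0 < n)%N -> coset2 (cell_base t) a ->
  is_maximal_order (@equation_order _ (monic_poly a)) <->
  coprimep (sqrt_part (monic_poly t.1)) (rVpoly t.2).
Proof.
move=> n_gt0 /coset2_cell_base[U [_ <- aE]].
have [mr mh sh sz _] := sqrt_lift_spec t.1.
have mf := monic_polyP a; have sf := size_monic_poly a.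
rewrite aE in mf sf *; rewrite dedekind_criterion ?sf //.
by rewrite liftpK.
Qed.

Lemma disc_ndvd_cell t a : (0 < n)%N -> coset2 (cell_base t) a ->
  ~ padic_dvd p%:R (disc (monic_poly a)) <-> separable_poly (monic_poly t.1).
Proof.
move=> n_gt0 /coset2_cell_base[U [sU _ ->]].
have [mr mh sh sz _] := sqrt_lift_spec t.1.
have n1 := prednK n_gt0; have {}sU : (size U <= n.-1.+1)%N by rewrite n1.
have {}sz : size (sqrt_lift t.1 ^+ 2 * sqfree_lift t.1) = n.-1.+2 by rewrite n1.
by rewrite (disc_ndvd mr mh sh sz sU) liftpK sqrt_part_size1.
Qed.

Lemma disc_val1_cell t a : (0 < n)%N -> coset2 (cell_base t) a ->
  padic_val (disc (monic_poly a)) 1 <->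
  size (sqrt_part (monic_poly t.1)) = 2%N /\
  coprimep (sqrt_part (monic_poly t.1))
    (2%:R * sqfree_part (monic_poly t.1) * rVpoly t.2).
Proof.
move=> n_gt0 /coset2_cell_base[U [sU <- ->]].
have [mr mh sh sz _] := sqrt_lift_spec t.1.
have n1 := prednK n_gt0; have {}sU : (size U <= n.-1.+1)%N by rewrite n1.
have {}sz : size (sqrt_lift t.1 ^+ 2 * sqfree_lift t.1) = n.-1.+2 by rewrite n1.
by rewrite (disc_val1 mr mh sh sz sU) !liftpK.
Qed.

End Digits.

Theorem theorem6p1 (R : realType) (n : nat) (hn : (2 <= n)%N)
    (p : nat) (pr_p : prime p)
    (mu : {measure set (borel_rV pr_p n) -> \bar R}) (haar_mu : is_haar mu) :
  let q : R := p%:R in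
  [/\ P_max mu (unit_const pr_p n) =
        1 - 1 / (q ^+ 2 + q + 1) +
        (if odd n then 1 / ((q ^+ 2 + q + 1) * q ^+ (3 * (n - 1))./2)
         else - ((q + 1) / ((q ^+ 2 + q + 1) * q ^+ ((3 * n)./2 - 1)))),
      P0_sqf mu (unit_const pr_p n) =
        q / (q + 1) * (1 - (-1) ^+ n / q ^+ n),
      p = 2%N -> P1_sqf mu (unit_const pr_p n) = 0
    & odd p -> P1_sqf mu (unit_const pr_p n) =
        (q - 1) ^+ 2 / (q * (q + 1) ^+ 2) -
        (-1) ^+ n / q ^+ n *
        ((n%:R - 1) * ((q - 1) ^+ 2 / (q + 1)) -
         q * (q - 1) * (q + 3) / (q + 1) ^+ 2)].
Proof.
move=> q; have n_gt0 : (0 < n)%N by apply: ltn_trans hn.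
pose F := 'F_p; have qE : #|F| = p by apply: card_Fp.
pose QW := finset.setX (const_neq0 F n) [set: 'rV[F]_n]%SET.
have cardQW : #|QW| = (#|F| ^ n * #|const_neq0 F n|)%N.
  by rewrite cardsX cardsT card_rV mulnC.
have WQ t a : coset2 (cell_base pr_p t) a -> unit_const pr_p n a <-> t \in QW.
  by case: t => x u /unit_const_cell ->; rewrite finset.in_setX finset.in_setT andbT.
have dens := density_cells haar_mu (@cell_cover _ pr_p n) (@cell_disj _ pr_p n).
have simpleP t a : coset2 (cell_base pr_p t) a -> unit_const pr_p n a ->
    padic_val (disc (monic_poly a)) 1 <-> (t.1 \in const_neq0 F n) &&
    ((size (sqrt_part (monic_poly t.1)) == 2%N) && coprimep (sqrt_part (monic_poly t.1))
    (2%:R * sqfree_part (monic_poly t.1) * rVpoly t.2)).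
  move=> ta /(unit_const_cell ta) ->; rewrite (disc_val1_cell n_gt0 ta) /=.
  by split=> [[-> ->]|/andP[/eqP -> ->]].
split.
- rewrite /P_max (dens _ _ QW (coprime_pairs F n)) //.
  + by rewrite cardQW coprime_pairs_proportion // qE.
  + move=> t a ta /(unit_const_cell ta) t0.
    by rewrite /= (maximal_cell n_gt0 ta) inE t0.
  + by apply/fintype.subsetP => -[x u]; rewrite inE => /andP[x0 _]; apply/finset.setXP.
- rewrite /P0_sqf (dens _ _ QW (finset.setX (sqfree_rV F n) [set: 'rV[F]_n]%SET)) //.
  + by rewrite cardQW cardsX cardsT card_rV mulnC sqfree_proportion // qE.
  + move=> [x u] a ta /(unit_const_cell ta) x0.
    rewrite /= (disc_ndvd_cell n_gt0 ta) finset.in_setX finset.in_setT andbT.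
    by rewrite [x \in _]inE x0.
  + apply/fintype.subsetP => -[x u] /finset.setXP[]; rewrite inE => /andP[x0 _] _.
    exact/finset.setXP.
- move=> p2; rewrite /P1_sqf (dens _ _ QW finset.set0) ?cards0 ?mul0r ?finset.sub0set //.
  move=> t a ta /(simpleP _ _ ta) /= ->.
  (* In characteristic 2 the condition becomes coprimality of r with 0, which would make r constant,
     against deg r = 1. *)
  have -> : (2%:R : {poly F}) = 0 by rewrite -[2%N]p2 -polyC_natr pchar_Fp_0.
  rewrite !mul0r coprimep0 -size_poly_eq1.
  by have [->|_] := size (sqrt_part (monic_poly t.1)) =P 2%N; rewrite /= ?andbF finset.in_set0.
- move=> odd_p; rewrite /P1_sqf (dens _ _ QW (simple_pairs F n)) //.
  + by rewrite cardQW simple_pairs_proportion // qE.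
  + move=> t a ta /(simpleP _ _ ta) /= ->; rewrite [t \in _]inE.
    (* For odd p the factor 2 is a unit and can be removed from the coprimality condition. *)
    have c2 : (2%:R : F) != 0.
      rewrite -(dvdn_pcharf (pchar_Fp pr_p)).
      by rewrite gtnNdvd // ltn_neqAle prime_gt1 // andbT; apply: contraTneq odd_p => <-.
    by rewrite -polyC_natr -mulrA mul_polyC coprimepZr.
  + by apply/fintype.subsetP => -[x u]; rewrite inE => /and3P[x0 _ _]; apply/finset.setXP.
Qed.
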